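(* Let $A=(A(k,l))_{k,l\in\mathbb{Z}}$ be a complex matrix and let $r>0$. Assume that there is a constant $C$ such that $$\sup_{k\in\mathbb{Z}}|A(k,k)|<\infty,\qquad 2^{kr}\sum_{2^k\le|l|<2^{k+1}}\ \sup_{m\in\mathbb{Z}}|A(m,m-l)|\le C\quad\text{for all integers }k\ge 0 .$$ If $A$ is invertible on $\ell^2(\mathbb{Z})$, then the inverse matrix satisfies the same form of off-diagonal decay, i.e. there is a constant $C'$ such that $$\sup_{k\in\mathbb{Z}}|A^{-1}(k,k)|<\infty,\qquad 2^{kr}\sum_{2^k\le|l|<2^{k+1}}\ \sup_{m\in\mathbb{Z}}|A^{-1}(m,m-l)|\le C'\quad\text{for all integers }k\ge 0 .$$
   Context: In the inner sums $l$ ranges over the integers with $2^k\le |l|<2^{k+1}$. A matrix is identified with the operator it induces on $\ell^2(\mathbb{Z})$; ''invertible on $\ell^2(\mathbb{Z})$'' means bounded with bounded inverse, and $A^{-1}(k,l)$ are the matrix entries of the inverse with respect to the standard basis. *)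

(* Defs.v *)
From HB Require Import structures.
From mathcomp Require Import all_boot all_order all_algebra.
From mathcomp Require Import all_classical all_reals all_analysis.
From mathcomp Require Import complex ring.
From mathcomp Require showcase.summability.
Set Implicit Arguments.
Unset Strict Implicit.
Unset Printing Implicit Defensive.
Import Order.TTheory GRing.Theory Num.Theory.
Import numFieldNormedType.Exports.
Import ComplexField.Normc.
Local Open Scope classical_set_scope.
Local Open Scope ring_scope.
Local Open Scope complex_scope.

Definition zmatrix (R : realType) := int -> int -> R[i].

Section decay.
Context {R : realType}.
Implicit Types (A : zmatrix R) (r : R).

(* Extended real: it is +oo exactly when the l-th side diagonal is unbounded. *)
Definition diag_sup A (l : int) : \bar R :=
  ereal_sup (range (fun m : int => (normc (A m (m - l)))%:E)).

Definition dyadic_shell (k : nat) : set int :=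
  [set l : int | (2 ^ k <= `|l| < 2 ^ k.+1)%N].

Definition dyadic_decay r A : Prop :=
  (ereal_sup (range (fun k : int => (normc (A k k))%:E)) < +oo)%E /\
  exists C : R, forall k : nat,
    ((2 `^ (k%:R * r))%:E * (\esum_(l in dyadic_shell k) diag_sup A l) <= C%:E)%E.

End decay.

Section l2.
Context {R : realType}.
Implicit Types x y : int -> R[i].

Definition l2energy x : \bar R := (\esum_(k in setT) (normc (x k) ^+ 2)%:E)%E.

Definition square_summable : {pred int -> R[i]} :=
  mem [set x | (l2energy x < +oo)%E].

Lemma square_summable_submod_closed : submod_closed square_summable.
Proof.
split=> [|a x y]; rewrite !inE /= /l2energy.
- rewrite esum1 ?ltry// => k _.
  by rewrite normc0 expr0n.
move=> fx fy.
set c := Num.max 1 (2 * normc a ^+ 2 + 2).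
have c0 : 0 <= c by rewrite le_max ler01.
have pos (z : int -> R[i]) (k : int) : (0 <= (normc (z k) ^+ 2)%:E :> \bar R)%E.
  by rewrite lee_fin sqr_ge0.
apply: (@le_lt_trans _ _ (c%:E * \esum_(k in setT)
    ((normc (x k) ^+ 2)%:E + (normc (y k) ^+ 2)%:E))%E); last first.
  rewrite esumD//.
  apply: lte_mul_pinfty; rewrite ?lee_fin ?fin_numE//.
  by rewrite lte_add_pinfty.
apply: ge_ereal_sup => _ [F [finF _] <-].
apply: (@le_trans _ _ (c%:E * (\sum_(k \in F)
    ((normc (x k) ^+ 2)%:E + (normc (y k) ^+ 2)%:E)))%E); last first.
  apply: lee_wpmul2l; rewrite ?lee_fin//.
  by apply: ereal_sup_ubound; exists F.
rewrite ge0_mule_fsumr; last by move=> k; rewrite adde_ge0 ?pos.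
apply: lee_fsum => // k _.
rewrite -EFinD -EFinM lee_fin.
have h : normc ((a *: x + y) k) <= normc a * normc (x k) + normc (y k).
  by rewrite -normcM; exact: le_normcD.
have [na nx ny nz] : [/\ 0 <= normc a, 0 <= normc (x k), 0 <= normc (y k)
    & 0 <= normc ((a *: x + y) k)].
  have p (z : R[i]) : 0 <= normc z by case: z => ? ?; exact: sqrtr_ge0.
  by split; exact: p.
apply: (@le_trans _ _ ((normc a * normc (x k) + normc (y k)) ^+ 2)).
  by rewrite ler_pXn2r// nnegrE// addr_ge0// mulr_ge0.
apply: (@le_trans _ _
    ((2 * normc a ^+ 2 + 2) * (normc (x k) ^+ 2 + normc (y k) ^+ 2))).
  have : 0 <= (normc a * normc (x k) - normc (y k)) ^+ 2 by exact: sqr_ge0.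
  have := mulr_ge0 (sqr_ge0 (normc a)) (sqr_ge0 (normc (y k))).
  have := sqr_ge0 (normc (x k)).
  move: (normc a) (normc (x k)) (normc (y k)) => u v w.
  move=> h1 h2 h3.
  rewrite -subr_ge0.
  have -> : (2 * u ^+ 2 + 2) * (v ^+ 2 + w ^+ 2) - (u * v + w) ^+ 2 =
    2 * (u ^+ 2 * w ^+ 2) + 2 * v ^+ 2 + (u * v - w) ^+ 2.
    by rewrite !expr2; ring.
  by rewrite addr_ge0// addr_ge0// mulr_ge0.
rewrite ler_wpM2r ?addr_ge0 ?sqr_ge0//.
by rewrite le_max lexx orbT.
Qed.

HB.instance Definition _ :=
  GRing.isSubmodClosed.Build _ _ square_summable square_summable_submod_closed.

Lemma square_summable_unit (l : int) :
  (fun k : int => (k == l)%:R : R[i]) \in square_summable.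
Proof.
rewrite inE /= /l2energy (esumID [set l])// ?setTI.
- rewrite esum_set1 ?lee_fin ?sqr_ge0// esum1 ?adde0 ?ltry// => k kl.
  have /negbTE -> : k != l by apply/eqP.
  by rewrite normc0 expr0n.
- by move=> k _; rewrite lee_fin sqr_ge0.
Qed.

End l2.

Record l2 (R : realType) := L2 {
  l2fun :> int -> R[i];
  l2funP : l2fun \in square_summable }.

HB.instance Definition _ (R : realType) := [isSub for @l2fun R].
HB.instance Definition _ (R : realType) := [Choice of l2 R by <:].
HB.instance Definition _ (R : realType) :=
  [SubChoice_isSubLmodule of l2 R by <:].

Section operators.
Context {R : realType}.
Implicit Types (A : zmatrix R) (T : {linear l2 R -> l2 R}).

Definition l2norm (x : l2 R) : R := Num.sqrt (fine (l2energy x)).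

Definition l2unit (l : int) : l2 R := L2 (square_summable_unit l).

Definition l2_bounded T : Prop :=
  exists M : R, forall x : l2 R, l2norm (T x) <= M * l2norm x.

(* (T x)(k) is the sum over l of A(k,l) x(l), as the limit of the net of sums
   over finite sets of indices. *)
Definition induces A T : Prop :=
  forall (x : l2 R) (k : int),
    summability.partial_sum (fun l : int => A k l * x l : R[i]^o)
      @ summability.totally --> (T x k : R[i]^o).

Definition matrix_of T : zmatrix R := fun k l => T (l2unit l) k.

End operators.

(* Main.v *)
Require Import Defs.
From mathcomp Require Import all_boot all_order all_algebra.
From mathcomp Require Import all_classical all_reals all_analysis.
From mathcomp Require Import finmap complex.
From mathcomp Require Import ring lra zify.
From mathcomp Require showcase.summability.
Import Order.TTheory GRing.Theory Num.Theory.
Import numFieldNormedType.Exports.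
Import ComplexField.Normc.
Set Implicit Arguments.
Unset Strict Implicit.
Unset Printing Implicit Defensive.
Local Open Scope classical_set_scope.
Local Open Scope ring_scope.
Local Open Scope complex_scope.

(** Put [rho = 2^r] and consider matrices dominated along their diagonals by a
    sequence [a] with [rho^k * sum_(|l| >= 2^k) a l <= alpha]. If the entries of
    the matrix are at most [eps], then [a] may be replaced by [min a eps], of
    total mass at most [2^(n+1) eps + alpha rho^-n] for every [n]. The decay
    constant of a convolution is at most [rho] times the sum of the two products
    (decay constant) * (total mass), so squaring a matrix with small entries
    gains over the submultiplicative estimate. Hence, if [Q] in this class is an
    [l2] contraction, the decay constants of [Q ^ (m * 2^j)] tend to [0] for a
    suitable [m] (Brandenburg's trick). This is applied to [Q = 1 - A^* A / mu].
    The inverse [Y] solves [Y = Q Y + A^* / mu], hence [Y = Z Y + G] with [Z] a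
    power of [Q] of small decay constant and [G] in the class, and the Neumann
    iteration of this equation on the suprema of the diagonals of [Y] gives the
    decay of [Y]. *)

(** * Unordered sums of nonnegative extended reals *)

Section nonnegative_sums.
Context {R : realType} {I J : choiceType}.
Implicit Types (a b : I -> \bar R).
Local Open Scope ereal_scope.

Lemma esum_swap (a : I -> J -> \bar R) : (forall i j, 0 <= a i j) ->
  \esum_(i in setT) \esum_(j in setT) a i j =
  \esum_(j in setT) \esum_(i in setT) a i j.
Proof.
move=> a0; rewrite !esum_esum//.
rewrite (reindex_esum (setT `*`` (fun=> setT)) _ (fun x : J * I => (x.2, x.1)))//.
split=> //=; first by move=> [i1 i2] [j1 j2] /= _ _ [] -> ->.
by move=> [i1 i2] _; exists (i2, i1).
Qed.

Lemma esum_sub (D E : set I) a : (forall i, 0 <= a i) -> D `<=` E ->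
  \esum_(i in D) a i <= \esum_(i in E) a i.
Proof.
move=> a0 DE; apply: ereal_sup_le => _ [F [finF FD] <-].
by exists F => //; split=> // x /FD /DE.
Qed.

Lemma esum_ge_term (D : set I) a i : (forall i, 0 <= a i) -> D i ->
  a i <= \esum_(i in D) a i.
Proof.
move=> a0 Di; rewrite -[leLHS](@esum_set1 _ _ i a)//.
by apply: esum_sub => // _ ->.
Qed.

Lemma esumZ (D : set I) (c : \bar R) a : 0 <= c -> (forall i, 0 <= a i) ->
  \esum_(i in D) (c * a i) = c * \esum_(i in D) a i.
Proof.
move=> c0 a0.
(* For a finite positive constant one inequality is enough: the reverse one follows by applying it
   to [c^-1] and the family [c * a]. *)
have le (c' : R) (b : I -> \bar R) : (0 <= c')%R -> (forall i, 0 <= b i) ->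
    \esum_(i in D) (c'%:E * b i) <= c'%:E * \esum_(i in D) b i.
  move=> c'0 b0; apply: ge_ereal_sup => _ [F [finF FD] <-].
  rewrite -ge0_mule_fsumr//; apply: lee_wpmul2l; rewrite ?lee_fin//.
  by apply: ereal_sup_ubound; exists F.
case: c c0 => [c| |]// c0.
  have [->|cn0] := eqVneq c 0%R.
    by rewrite mul0e esum1// => i _; rewrite mul0e.
  have cp : (0 < c)%R by rewrite lt_neqAle eq_sym cn0 -lee_fin.
  apply/eqP; rewrite eq_le; apply/andP; split; first exact: le (ltW cp) a0.
  rewrite -lee_pdivlMl//.
  have ca0 i : 0 <= c%:E * a i by rewrite mule_ge0// lee_fin ltW.
  have ci0 : (0 <= c^-1)%R by rewrite invr_ge0 ltW.
  apply: le_trans (le _ _ ci0 ca0).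
  by apply: le_esum => i _; rewrite muleA -EFinM mulVf// mul1e.
(* For [c = +oo] both sides are [+oo] as soon as one term is positive, and both are [0]
   otherwise. *)
have [[i [Di ai]]|no] := pselect (exists i, D i /\ 0 < a i).
  rewrite gt0_mulye ?(lt_le_trans ai (esum_ge_term a0 Di))//.
  apply/eqP; rewrite -leye_eq -{1}(gt0_mulye ai).
  by apply: (esum_ge_term (a := fun i => +oo * a i)) => // j; rewrite mule_ge0.
have az k : D k -> a k = 0.
  move=> Dk; apply/eqP; rewrite eq_le a0 andbT leNgt; apply/negP => ak.
  by apply: no; exists k.
rewrite (esum1 az) mule0 esum1// => k Dk.
by rewrite az// mule0.
Qed.

Lemma reindexT_esum (e : J -> I) a : bijective e ->
  \esum_(i in setT) a i = \esum_(j in setT) a (e j).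
Proof.
by move=> ebij; apply: reindex_esum; rewrite setTT_bijective.
Qed.

End nonnegative_sums.

(** * Absolutely summable families of real numbers *)

Section real_sums.
Context {R : realType}.
Local Open Scope ring_scope.

Section one_index.
Context {I : choiceType}.
Implicit Types (f g h : I -> R) (c : R).

(** An infinite sum gets the value [0], which is what [fine] returns on [+oo]. *)
Definition nsum g : R := fine (\esum_(i in setT) (g i)%:E)%E.

Definition rsummable f := (\esum_(i in setT) `|f i|%:E < +oo)%E.

Lemma le_rsummable g f : (forall i, `|f i| <= g i) -> rsummable g -> rsummable f.
Proof.
move=> fg; apply: le_lt_trans; apply: le_esum => i _.
by rewrite lee_fin (le_trans (fg i))// ler_norm.
Qed.

Lemma rsummableD f g : rsummable f -> rsummable g -> rsummable (fun i => f i + g i).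
Proof.
move=> sf sg; apply: (@le_rsummable (fun i => `|f i| + `|g i|)).
  by move=> i; exact: ler_normD.
rewrite /rsummable; under eq_esum do rewrite ger0_norm ?addr_ge0// EFinD.
by rewrite esumD ?lte_add_pinfty// => i _; rewrite lee_fin.
Qed.

Lemma rsummableZ c f : rsummable f -> rsummable (fun i => c * f i).
Proof.
rewrite /rsummable => sf.
under eq_esum do rewrite normrM EFinM.
by rewrite esumZ// lte_mul_pinfty.
Qed.

Lemma nsumE g : (forall i, 0 <= g i) -> rsummable g ->
  (\esum_(i in setT) (g i)%:E)%E = (nsum g)%:E.
Proof.
move=> g0 sg; rewrite /nsum fineK// ge0_fin_numE; last first.
  by apply: esum_ge0 => i _; rewrite lee_fin.
by move: sg; rewrite /rsummable; under eq_esum do rewrite ger0_norm//.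
Qed.

Lemma nsumD g h : (forall i, 0 <= g i) -> (forall i, 0 <= h i) ->
  rsummable g -> rsummable h -> nsum (fun i => g i + h i) = nsum g + nsum h.
Proof.
move=> g0 h0 sg sh; apply: EFin_inj.
rewrite -nsumE; [|by move=> i; rewrite addr_ge0|exact: rsummableD].
under eq_esum do rewrite EFinD.
by rewrite esumD ?nsumE// => i _; rewrite lee_fin.
Qed.

Lemma nsum_ge0 g : (forall i, 0 <= g i) -> 0 <= nsum g.
Proof. by move=> g0; apply/fine_ge0/esum_ge0 => i _; rewrite lee_fin. Qed.

Lemma le_nsum g h : (forall i, 0 <= g i) -> (forall i, g i <= h i) ->
  rsummable h -> nsum g <= nsum h.
Proof.
move=> g0 gh sh; rewrite -lee_fin -!nsumE//.
- by apply: le_esum => i _; rewrite lee_fin.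
- by move=> i; exact: le_trans (gh i).
- by apply: le_rsummable sh => i; rewrite ger0_norm.
Qed.

Lemma nsumZ c g : 0 <= c -> (forall i, 0 <= g i) -> rsummable g ->
  nsum (fun i => c * g i) = c * nsum g.
Proof.
move=> c0 g0 sg; apply: EFin_inj; rewrite -nsumE.
- by under eq_esum do rewrite EFinM; rewrite esumZ ?nsumE.
- by move=> i; rewrite mulr_ge0.
- exact: rsummableZ.
Qed.

Definition rsum f : R :=
  nsum (fun i => Num.max (f i) 0) - nsum (fun i => Num.max (- f i) 0).

Let max0 (x : R) : 0 <= Num.max x 0. Proof. by rewrite le_max lexx orbT. Qed.
Let max_norm (x : R) : `|Num.max x 0| <= `|x|.
Proof. by rewrite ger0_norm// ge_max ler_norm normr_ge0. Qed.
Let max_normN (x : R) : `|Num.max (- x) 0| <= `|x|.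
Proof. by rewrite ger0_norm// ge_max -[leRHS]normrN ler_norm normr_ge0. Qed.

Lemma rsummable_pos f : rsummable f -> rsummable (fun i => Num.max (f i) 0).
Proof.
move=> sf; apply: (@le_rsummable (fun i => `|f i|)) => //.
by rewrite /rsummable; under eq_esum do rewrite normr_id.
Qed.

Lemma rsummable_neg f : rsummable f -> rsummable (fun i => Num.max (- f i) 0).
Proof.
move=> sf; apply: (@le_rsummable (fun i => `|f i|)) => //.
by rewrite /rsummable; under eq_esum do rewrite normr_id.
Qed.

(** Any splitting into a difference of nonnegative summable families computes [rsum]: writing [p]
    and [q] for the positive and negative parts of [g - h], one has [p + h = q + g], and [nsum] is
    additive. Additivity of [rsum] and the exchange of two sums rest on this. *)
Lemma rsumB g h : (forall i, 0 <= g i) -> (forall i, 0 <= h i) ->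
  rsummable g -> rsummable h -> rsum (fun i => g i - h i) = nsum g - nsum h.
Proof.
move=> g0 h0 sg sh.
have sB : rsummable (fun i => g i - h i).
  by apply: (@le_rsummable (fun i => g i + h i));
    [move=> i; rewrite (le_trans (ler_normB _ _))// !ger0_norm | exact: rsummableD].
have E : nsum (fun i => Num.max (g i - h i) 0) + nsum h =
         nsum (fun i => Num.max (- (g i - h i)) 0) + nsum g.
  rewrite -!nsumD//; [|exact: rsummable_neg|exact: rsummable_pos].
  congr nsum; apply/funext => i; rewrite /Num.max.
  by case: ltP => ?; case: ltP => ?; lra.
by rewrite /rsum; lra.
Qed.

Lemma rsum_nsum g : (forall i, 0 <= g i) -> rsummable g -> rsum g = nsum g.
Proof.
move=> g0 sg; rewrite -[RHS]subr0.
have -> : 0 = nsum (fun=> 0 : R) by rewrite /nsum esum1.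
rewrite -rsumB//; first by congr rsum; apply/funext => i; rewrite subr0.
by rewrite /rsummable esum1 ?ltry// => i _; rewrite normr0.
Qed.

Lemma rsumD f g : rsummable f -> rsummable g ->
  rsum (fun i => f i + g i) = rsum f + rsum g.
Proof.
move=> sf sg; rewrite [in RHS]/rsum.
set f1 := fun i => Num.max (f i) 0; set f2 := fun i => Num.max (- f i) 0.
set g1 := fun i => Num.max (g i) 0; set g2 := fun i => Num.max (- g i) 0.
have -> : (fun i => f i + g i) = (fun i => (f1 i + g1 i) - (f2 i + g2 i)).
  apply/funext => i; rewrite /f1 /f2 /g1 /g2 /Num.max.
  by do 4!case: ltP => ?; lra.
have sf1 : rsummable f1 := rsummable_pos sf.
have sf2 : rsummable f2 := rsummable_neg sf.
have sg1 : rsummable g1 := rsummable_pos sg.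
have sg2 : rsummable g2 := rsummable_neg sg.
have [f10 f20] : (forall i, 0 <= f1 i) /\ (forall i, 0 <= f2 i).
  by split=> i; exact: max0.
have [g10 g20] : (forall i, 0 <= g1 i) /\ (forall i, 0 <= g2 i).
  by split=> i; exact: max0.
have p1 i : 0 <= f1 i + g1 i by exact: addr_ge0.
have p2 i : 0 <= f2 i + g2 i by exact: addr_ge0.
rewrite (rsumB p1 p2 (rsummableD sf1 sg1) (rsummableD sf2 sg2)).
by rewrite !nsumD//; ring.
Qed.

Lemma rsumN f : rsum (fun i => - f i) = - rsum f.
Proof.
rewrite /rsum opprB; congr (_ - _); congr nsum; apply/funext => i.
by rewrite opprK.
Qed.

Lemma rsumZ c f : rsummable f -> rsum (fun i => c * f i) = c * rsum f.
Proof.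
move=> sf; wlog c0 : c / 0 <= c => [hw|].
  have [|c0] := leP 0 c; first exact: hw.
  rewrite -[c]opprK mulNr -hw ?oppr_ge0 ?ltW// -rsumN.
  by congr rsum; apply/funext => i; rewrite mulNr.
rewrite /rsum mulrBr -!nsumZ//; [|exact: rsummable_neg|exact: rsummable_pos].
congr (_ - _); congr nsum; apply/funext => i.
  by rewrite maxr_pMr// mulr0.
by rewrite maxr_pMr// mulr0 mulrN.
Qed.

Lemma rsum_norm f : rsummable f -> `|rsum f| <= nsum (fun i => `|f i|).
Proof.
move=> sf.
have sn : rsummable (fun i => `|f i|).
  by rewrite /rsummable; under eq_esum do rewrite normr_id.
have h1 : nsum (fun i => Num.max (f i) 0) <= nsum (fun i => `|f i|).
  by apply: le_nsum => // i; rewrite ge_max ler_norm normr_ge0.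
have h2 : nsum (fun i => Num.max (- f i) 0) <= nsum (fun i => `|f i|).
  by apply: le_nsum => // i; rewrite ge_max -[leRHS]normrN ler_norm normr_ge0.
have h3 := nsum_ge0 (fun i => max0 (f i)).
have h4 := nsum_ge0 (fun i => max0 (- f i)).
by rewrite /rsum ler_norml; lra.
Qed.

End one_index.

Section two_indices.
Context {I J : choiceType}.

Lemma rsum_swap (f : I -> J -> R) :
  (\esum_(i in setT) \esum_(j in setT) `|f i j|%:E < +oo)%E ->
  rsum (fun i => rsum (f i)) = rsum (fun j => rsum (fun i => f i j)).
Proof.
(* The iterated sum is a difference of two double sums of nonnegative terms, and in each of these
   the order may be exchanged by [esum_swap]. *)
suff main (I1 I2 : choiceType) (g : I1 -> I2 -> R) :
    (\esum_(i in setT) \esum_(j in setT) `|g i j|%:E < +oo)%E ->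
    rsum (fun i => rsum (g i)) =
    fine (\esum_(i in setT) \esum_(j in setT) (Num.max (g i j) 0)%:E)%E -
    fine (\esum_(i in setT) \esum_(j in setT) (Num.max (- g i j) 0)%:E)%E.
  move=> sf; rewrite (main _ _ _ sf).
  rewrite (main _ _ (fun j i => f i j)); last by rewrite -esum_swap.
  have max0 (x : R) : (0 <= (Num.max x 0)%:E)%E by rewrite lee_fin le_max lexx orbT.
  by congr (fine _ - fine _); exact: esum_swap.
move=> sg.
have max0 (x : R) : 0 <= Num.max x 0 by rewrite le_max lexx orbT.
have sgi i : rsummable (g i).
  apply: le_lt_trans sg.
  apply: (esum_ge_term (a := fun i => \esum_(j in setT) `|g i j|%:E)%E).
  by move=> k; exact: esum_ge0.
  by [].
have E1 i : (\esum_(j in setT) (Num.max (g i j) 0)%:E)%E =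
    (nsum (fun j => Num.max (g i j) 0))%:E by rewrite nsumE//; exact: rsummable_pos.
have E2 i : (\esum_(j in setT) (Num.max (- g i j) 0)%:E)%E =
    (nsum (fun j => Num.max (- g i j) 0))%:E by rewrite nsumE//; exact: rsummable_neg.
rewrite (eq_esum (fun i _ => E1 i)) (eq_esum (fun i _ => E2 i)).
apply: (rsumB (g := fun i => nsum (fun j => Num.max (g i j) 0))
             (h := fun i => nsum (fun j => Num.max (- g i j) 0))).
- by move=> i; exact: nsum_ge0.
- by move=> i; exact: nsum_ge0.
- apply: le_lt_trans sg; apply: le_esum => i _.
  rewrite ger0_norm ?nsum_ge0// -E1; apply: le_esum => j _.
  by rewrite lee_fin ge_max ler_norm normr_ge0.
- apply: le_lt_trans sg; apply: le_esum => i _.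
  rewrite ger0_norm ?nsum_ge0// -E2; apply: le_esum => j _.
  by rewrite lee_fin ge_max -[leRHS]normrN ler_norm normr_ge0.
Qed.

End two_indices.
End real_sums.

(** * The modulus of complex numbers *)

Section complex_modulus.
Context {R : realType}.
Implicit Types z : R[i].

Lemma normc_ge0 z : 0 <= normc z.
Proof. by case: z => ? ?; exact: sqrtr_ge0. Qed.

Lemma normc_conjc z : normc (conjc z) = normc z.
Proof. by case: z => a b /=; rewrite sqrrN. Qed.

Lemma normc_real (x : R) : normc x%:C = `|x|.
Proof. by rewrite /= expr0n addr0 sqrtr_sqr. Qed.

Lemma le_Re_normc z : `|complex.Re z| <= normc z.
Proof.
by case: z => a b /=; rewrite -sqrtr_sqr ler_sqrt ?lerDl ?addr_ge0 ?sqr_ge0.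
Qed.

Lemma le_Im_normc z : `|complex.Im z| <= normc z.
Proof.
by case: z => a b /=; rewrite -sqrtr_sqr ler_sqrt ?lerDr ?addr_ge0 ?sqr_ge0.
Qed.

Lemma normcB (x y : R[i]) : normc (x - y) <= normc x + normc y.
Proof. by rewrite -(normcN y) le_normcD. Qed.

Lemma mul_conjc z : z * conjc z = (normc z ^+ 2)%:C.
Proof.
case: z => a b; apply/eqP; rewrite eq_complex /=.
by rewrite sqr_sqrtr ?addr_ge0 ?sqr_ge0// !expr2; apply/andP; split; apply/eqP; ring.
Qed.

End complex_modulus.

(** * Absolutely summable families of complex numbers *)

Section complex_sums.
Context {R : realType}.

Section one_index.
Context {I : choiceType}.
Implicit Types (f g : I -> R[i]) (c : R[i]).

Definition csum f : R[i] :=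
  rsum (fun i => complex.Re (f i)) +i* rsum (fun i => complex.Im (f i)).

Definition csummable f := rsummable (fun i => normc (f i)).

Lemma csummableE f :
  csummable f <-> (\esum_(i in setT) (normc (f i))%:E < +oo)%E.
Proof.
rewrite /csummable /rsummable.
by under eq_esum do rewrite ger0_norm ?normc_ge0//.
Qed.

Lemma le_csummable (g : I -> R) f :
  (forall i, normc (f i) <= g i) -> rsummable g -> csummable f.
Proof.
by move=> fg; apply: le_rsummable => i; rewrite ger0_norm ?normc_ge0.
Qed.

Lemma csummableD f g : csummable f -> csummable g ->
  csummable (fun i => f i + g i).
Proof.
move=> sf sg; apply: (le_csummable (g := fun i => normc (f i) + normc (g i))).
  by move=> i; exact: le_normcD.
exact: rsummableD.
Qed.

Lemma csummableB f g : csummable f -> csummable g ->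
  csummable (fun i => f i - g i).
Proof.
move=> sf sg; apply: csummableD => //.
by apply: le_csummable sg => i; rewrite normcN.
Qed.

Lemma csummableM (B : R) f g : (forall i, normc (g i) <= B) -> csummable f ->
  csummable (fun i => f i * g i).
Proof.
move=> gB sf; apply: (le_csummable (g := fun i => B * normc (f i))).
  by move=> i; rewrite normcM mulrC ler_wpM2r ?normc_ge0.
exact: rsummableZ.
Qed.

Lemma csummableZ c f : csummable f -> csummable (fun i => c * f i).
Proof.
move=> sf; apply: (le_csummable (g := fun i => normc c * normc (f i))).
  by move=> i; rewrite normcM.
exact: rsummableZ.
Qed.

Lemma csummable_Re f : csummable f -> rsummable (fun i => complex.Re (f i)).
Proof. by apply: le_rsummable => i; exact: le_Re_normc. Qed.

Lemma csummable_Im f : csummable f -> rsummable (fun i => complex.Im (f i)).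
Proof. by apply: le_rsummable => i; exact: le_Im_normc. Qed.

Lemma csumD f g : csummable f -> csummable g ->
  csum (fun i => f i + g i) = csum f + csum g.
Proof.
move=> sf sg; apply/eqP; rewrite eq_complex /=; apply/andP; split; apply/eqP.
  rewrite -rsumD; [|exact: csummable_Re..].
  by congr rsum; apply/funext => i; case: (f i) (g i) => ? ? [].
rewrite -rsumD; [|exact: csummable_Im..].
by congr rsum; apply/funext => i; case: (f i) (g i) => ? ? [].
Qed.

Lemma csumZ c f : csummable f -> csum (fun i => c * f i) = c * csum f.
Proof.
move=> sf; have [sR sI] := (csummable_Re sf, csummable_Im sf).
case: c => a b; apply/eqP; rewrite eq_complex /=; apply/andP; split; apply/eqP.
  rewrite -!rsumZ// -rsumN -rsumD.
  - by congr rsum; apply/funext => i; case: (f i).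
  - exact: rsummableZ.
  - under [X in rsummable X]funext do rewrite -mulNr.
    exact: rsummableZ.
rewrite -!rsumZ// -rsumD; [|exact: rsummableZ..].
by congr rsum; apply/funext => i; case: (f i).
Qed.

Lemma csumN f : csum (fun i => - f i) = - csum f.
Proof.
apply/eqP; rewrite eq_complex /= -!rsumN; apply/andP; split; apply/eqP;
by congr rsum; apply/funext => i; case: (f i).
Qed.

Lemma csumB f g : csummable f -> csummable g ->
  csum (fun i => f i - g i) = csum f - csum g.
Proof.
move=> sf sg; rewrite -csumN -csumD//.
by apply: le_csummable sg => i; rewrite normcN.
Qed.

Lemma csumJ f : csum (fun i => conjc (f i)) = conjc (csum f).
Proof.
rewrite /csum /= -rsumN; congr (_ +i* _);
by congr rsum; apply/funext => i; case: (f i).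
Qed.

Lemma csum_real (g : I -> R) : (forall i, 0 <= g i) -> rsummable g ->
  csum (fun i => (g i)%:C) = (nsum g)%:C.
Proof.
move=> g0 sg; rewrite /csum /= rsum_nsum//; congr (_ +i* _).
by rewrite /rsum /= oppr0 subrr.
Qed.

(* Rotating the sum onto the positive real axis reduces to real parts. *)
Lemma normc_csum f : csummable f -> normc (csum f) <= nsum (fun i => normc (f i)).
Proof.
move=> sf; set z := csum f.
have [->|z0] := eqVneq z 0.
  by rewrite normc0 nsum_ge0// => i; exact: normc_ge0.
have nz : normc z != 0 by apply: contraNneq z0 => /eq0_normc ->.
pose u := conjc z / (normc z)%:C.
have nu : normc u = 1.
  by rewrite normcM normcV normc_conjc normc_real ger0_norm ?normc_ge0// divff.
have uz : u * z = (normc z)%:C.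
  rewrite /u mulrAC [_ * z]mulrC mul_conjc expr2 (rmorphM (real_complex R)) /= mulfK//.
  by apply: contra nz => /eqP; rewrite -[0]/((0 : R)%:C) => /complexI h; apply/eqP.
have su : csummable (fun i => u * f i) by exact: csummableZ.
have -> : normc z = rsum (fun i => complex.Re (u * f i)).
  by have := csumZ u sf; rewrite uz => /(congr1 (@complex.Re R)) /= ->.
apply: le_trans (ler_norm _) _.
apply: le_trans (rsum_norm (csummable_Re su)) _.
apply: le_nsum => // i.
by rewrite (le_trans (le_Re_normc _))// normcM nu mul1r.
Qed.

Lemma csum_term f j : (forall i, i != j -> f i = 0) -> csum f = f j.
Proof.
move=> f0.
have main (h : I -> R) : (forall i, i != j -> h i = 0) -> rsum h = h j.
  move=> h0.
  have pos (g : I -> R) : 0 <= g j -> (forall i, i != j -> g i = 0) -> nsum g = g j.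
    move=> gj g0; rewrite /nsum (esumID [set j]); last first.
      move=> i _; have [->//|/g0 ->] := eqVneq i j; rewrite ?lee_fin//.
    rewrite !setTI esum_set1 ?lee_fin// esum1 ?adde0// => i /= /eqP ij.
    by rewrite g0.
  rewrite /rsum !pos ?le_max ?lexx ?orbT//.
  - by rewrite /Num.max; do 2!case: ltP => ?; lra.
  - by move=> i /h0 ->; rewrite oppr0 maxxx.
  - by move=> i /h0 ->; rewrite maxxx.
rewrite /csum !main; first by case: (f j).
  by move=> i /f0 ->.
by move=> i /f0 ->.
Qed.

End one_index.

Lemma csum_swap (I J : choiceType) (f : I -> J -> R[i]) :
  (\esum_(i in setT) \esum_(j in setT) (normc (f i j))%:E < +oo)%E ->
  csum (fun i => csum (f i)) = csum (fun j => csum (fun i => f i j)).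
Proof.
move=> sf; rewrite /csum /=; congr (_ +i* _); apply: rsum_swap;
  apply: le_lt_trans sf; apply: le_esum => i _; apply: le_esum => j _;
  rewrite lee_fin; [exact: le_Re_normc|exact: le_Im_normc].
Qed.

End complex_sums.

(** * Sums as limits over the net of finite sets *)

Section unconditional_limits.
Context {R : realType} {I : choiceType}.
Implicit Types (f : I -> R[i]) (s : seq I).

Definition restrict_seq s f i : R[i] := if i \in s then f i else 0.

Lemma csummable_restrict s f : csummable f -> csummable (restrict_seq s f).
Proof.
apply: le_csummable => i; rewrite /restrict_seq.
by case: ifP => // _; rewrite normc0 normc_ge0.
Qed.

Lemma csum_restrict s f : csummable f -> uniq s ->
  csum (restrict_seq s f) = \sum_(i <- s) f i.
Proof.
move=> sf; elim: s => [_|j s IH /= /andP[js us]].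
  rewrite big_nil (_ : restrict_seq _ _ = fun i => 0 * f i).
    by rewrite csumZ// mul0r.
  by apply/funext => i; rewrite mul0r /restrict_seq in_nil.
rewrite big_cons -(IH us) -[f j](_ : csum (restrict_seq [:: j] f) = _).
  rewrite -csumD; [|exact: csummable_restrict..].
  congr csum; apply/funext => i; rewrite /restrict_seq !inE.
  by have [->|_] := eqVneq i j; rewrite ?(negbTE js) ?addr0 ?add0r.
by rewrite (csum_term (j := j)) /restrict_seq ?mem_head// => i; rewrite inE => /negbTE ->.
Qed.

(** As the sum of the moduli is a supremum over finite sets, some finite [X] carries all but [e] of
    it. The part of [f] off a finite set containing [X] then has moduli of sum at most [e], which
    bounds the error. *)
Lemma csum_approx f (e : R) : csummable f -> 0 < e ->
  exists F0 : {fset I}, forall F : {fset I}, (F0 `<=` F)%fset ->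
    normc (csum f - \sum_(i <- F) f i) <= e.
Proof.
move=> sf e0; set N := nsum (fun i => normc (f i)).
have nf0 i : 0 <= normc (f i) by exact: normc_ge0.
have : ((N - e)%:E < \esum_(i in setT) (normc (f i))%:E)%E.
  by rewrite nsumE// lte_fin ltrBlDr ltrDl.
move=> /ereal_sup_gt[_ [X [finX _] <-] NX].
exists (fset_set X) => F XF.
rewrite -csum_restrict ?fset_uniq// -csumB//; last exact: csummable_restrict.
pose g i := f i - restrict_seq F f i.
have sg : csummable g.
  apply: (le_csummable (g := fun i => normc (f i))) => // i.
  rewrite /g /restrict_seq.
  by case: ifP => _; rewrite ?subrr ?subr0 ?normc0.
apply: le_trans (normc_csum sg) _.
have NE : N = nsum (fun i => normc (g i)) + nsum (fun i => normc (restrict_seq F f i)).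
  rewrite -nsumD//; try by move=> i; exact: normc_ge0.
    congr nsum; apply/funext => i; rewrite /g /restrict_seq.
    by case: ifP => _; rewrite ?subrr ?subr0 normc0 ?add0r ?addr0.
  exact: csummable_restrict.
suff : N - e <= nsum (fun i => normc (restrict_seq F f i)) by lra.
rewrite -lee_fin -nsumE; last 2 first.
- by move=> i; exact: normc_ge0.
- exact: csummable_restrict.
apply: le_trans (ltW NX) _.
rewrite -esum_fset//; last by move=> i _; rewrite lee_fin.
apply: le_trans (esum_sub (D := X) (E := setT) _ _) => //; last first.
  by move=> i; rewrite lee_fin normc_ge0.
apply: le_esum => i Xi; rewrite /restrict_seq.
have iF : i \in F by apply: (fsubsetP XF); rewrite in_fset_set//; exact/mem_set.
by rewrite iF.
Qed.

(** Ties the limit in [induces] to [csum]: both numbers are within [e / 2] of the partial sum over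
    the union of [F0] and [F1]. *)
Lemma cvg_partial_sum_csum f (c : R[i]) : csummable f ->
  summability.partial_sum (f : I -> R[i]^o) @ summability.totally --> (c : R[i]^o) ->
  c = csum f.
Proof.
move=> sf cvf; apply/eqP; rewrite -subr_eq0; apply/eqP/eq0_normc/eqP.
rewrite eq_le normc_ge0 andbT; apply/ler_addgt0Pl => e e0; rewrite addr0.
have e20 : 0 < e / 2 by rewrite divr_gt0.
have [F0 hF0] := csum_approx sf e20.
have e2C : 0 < (e / 2)%:C :> R[i] by rewrite ltcR.
have FF := @summability.totally_filter I.
have /cvgrPdist_lt/(_ _ e2C)[F1 _ hF1] := cvf.
have := hF0 (F0 `|` F1)%fset (fsubsetUl _ _).
have := hF1 (F0 `|` F1)%fset (fsubsetUr _ _).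
rewrite /summability.partial_sum big_seq_fsetE.
set p : R[i] := \sum_(i : (F0 `|` F1)%fset) f (val i).
have -> (z : R[i]) : `|z| = (normc z)%:C by [].
rewrite ltcR => h1 h2.
have -> : c - csum f = (c - p) - (csum f - p) by ring.
by apply: le_trans (normcB _ _) _; lra.
Qed.
End unconditional_limits.

(** * Sequences of diagonal bounds: mass, tails and convolution *)

Section envelopes.
Context {R : realType}.
Implicit Types (a b : int -> \bar R) (n : nat).
Local Open Scope ereal_scope.

Definition mass a : \bar R := \esum_(l in setT) a l.

Definition outer n a l : \bar R := if (n <= `|l|)%N then a l else 0.

Definition tail a n : \bar R := mass (outer n a).

Definition convol a b l : \bar R := \esum_(j in setT) a j * b (l - j)%R.

Lemma outer_ge0 n a : (forall l, 0 <= a l) -> forall l, 0 <= outer n a l.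
Proof. by move=> a0 l; rewrite /outer; case: ifP. Qed.

Lemma mass_ge0 a : (forall l, 0 <= a l) -> 0 <= mass a.
Proof. by move=> a0; exact: esum_ge0. Qed.

Lemma tail_ge0 a n : (forall l, 0 <= a l) -> 0 <= tail a n.
Proof. by move=> a0; apply/mass_ge0/outer_ge0. Qed.

Lemma le_mass a b : (forall l, a l <= b l) -> mass a <= mass b.
Proof. by move=> ab; exact: le_esum. Qed.

Lemma le_tail a b n : (forall l, a l <= b l) -> tail a n <= tail b n.
Proof. by move=> ab; apply: le_mass => l; rewrite /outer; case: ifP. Qed.

Lemma massD a b : (forall l, 0 <= a l) -> (forall l, 0 <= b l) ->
  mass (fun l => a l + b l) = mass a + mass b.
Proof. by move=> a0 b0; rewrite /mass esumD. Qed.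

Lemma tailD a b n : (forall l, 0 <= a l) -> (forall l, 0 <= b l) ->
  tail (fun l => a l + b l) n = tail a n + tail b n.
Proof.
move=> a0 b0; rewrite /tail -massD; [|exact: outer_ge0..].
by congr mass; apply/funext => l; rewrite /outer; case: ifP => // _; rewrite adde0.
Qed.

Lemma massZ (c : \bar R) a : 0 <= c -> (forall l, 0 <= a l) ->
  mass (fun l => c * a l) = c * mass a.
Proof. by move=> c0 a0; rewrite /mass esumZ. Qed.

Lemma tailZ (c : \bar R) a n : 0 <= c -> (forall l, 0 <= a l) ->
  tail (fun l => c * a l) n = c * tail a n.
Proof.
move=> c0 a0; rewrite /tail -massZ//; last exact: outer_ge0.
by congr mass; apply/funext => l; rewrite /outer; case: ifP => // _; rewrite mule0.
Qed.

Lemma mass_delta (m : int) (c : \bar R) : 0 <= c ->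
  mass (fun l => if l == m then c else 0) = c.
Proof.
move=> c0; rewrite /mass (esumID [set m]); last by move=> l _; case: ifP.
rewrite !setTI esum_set1 ?eqxx// esum1 ?adde0// => l /= /eqP lm.
by rewrite (negbTE lm).
Qed.

Lemma mass_shift a (j : int) : mass (fun l => a (l - j)%R) = mass a.
Proof.
have bij : bijective (fun l : int => (l - j)%R).
  by exists (fun l : int => (l + j)%R) => l; rewrite ?subrK ?addrK.
by rewrite [RHS]/mass (reindexT_esum a bij).
Qed.

Lemma mass_opp a : mass (fun l => a (- l)%R) = mass a.
Proof. by rewrite [RHS]/mass (reindexT_esum a (inv_bij opprK)). Qed.

Lemma convol_ge0 a b : (forall l, 0 <= a l) -> (forall l, 0 <= b l) ->
  forall l, 0 <= convol a b l.
Proof. by move=> a0 b0 l; apply: esum_ge0 => j _; rewrite mule_ge0. Qed.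

Lemma le_convol a a' b b' : (forall l, 0 <= a l) -> (forall l, 0 <= b l) ->
  (forall l, a l <= a' l) -> (forall l, b l <= b' l) ->
  forall l, convol a b l <= convol a' b' l.
Proof. by move=> a0 b0 aa' bb' l; apply: le_esum => j _; exact: lee_pmul. Qed.

(** Tonelli's theorem and the translation invariance of the mass. *)
Lemma mass_convol a b : (forall l, 0 <= a l) -> (forall l, 0 <= b l) ->
  mass (convol a b) = mass a * mass b.
Proof.
move=> a0 b0; rewrite /mass /convol esum_swap; last first.
  by move=> i j; rewrite mule_ge0.
under eq_esum do rewrite esumZ// -/(mass _) mass_shift muleC.
by rewrite esumZ ?mass_ge0// muleC.
Qed.

(* If [j + (l - j) = l] and [2 n <= |l|], then [n <= |j|] or [n <= |l - j|]. *)
Lemma tail_convol a b n : (forall l, 0 <= a l) -> (forall l, 0 <= b l) ->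
  tail (convol a b) (n + n) <= tail a n * mass b + mass a * tail b n.
Proof.
move=> a0 b0; have [ca cb] := (outer_ge0 n a0, outer_ge0 n b0).
rewrite /tail -!mass_convol// -massD; [|exact: convol_ge0..].
apply: le_mass => l; rewrite {1}/outer; case: ifPn => [nl|_]; last first.
  by rewrite adde_ge0// convol_ge0.
rewrite -esumD; [|by move=> j _; rewrite mule_ge0..].
apply: le_esum => j _; rewrite /outer.
case: ifPn => [_|nj]; first by rewrite leeDl// mule_ge0//; case: ifP.
rewrite ifT ?mul0e ?add0e//.
by move: nl nj; lia.
Qed.

Lemma mass_near n (c : R) : (0 <= c)%R ->
  mass (fun l : int => if (`|l| < n)%N then c%:E else 0) <= (n%:R * (2 * c))%:E.
Proof.
move=> c0; elim: n => [|n IH].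
  by rewrite mul0r /mass esum1// => l _; rewrite ltn0.
rewrite -natr1 mulrDl mul1r EFinD.
apply: le_trans (leeD IH (lexx _)).
have cE : 0 <= c%:E by rewrite lee_fin.
(* Passing from [n] to [n.+1] adds the two points [n] and [-n]; for [n = 0] they coincide and the
   bound is merely not sharp. *)
have -> : (2 * c)%:E =
    mass (fun l => (if l == n%:Z then c%:E else 0) +
                    (if l == (- n%:Z)%R then c%:E else 0)).
  rewrite massD; [|by move=> l; case: ifP..].
  by rewrite !mass_delta// -EFinD; congr EFin; ring.
rewrite -massD; last 2 first.
- by move=> l; case: ifP.
- by move=> l; rewrite adde_ge0//; case: ifP.
apply: le_mass => l; case: ifPn => [ln|_]; last first.
  by rewrite !adde_ge0//; case: ifP.
have [l1|l1] := ltnP `|l| n; first by rewrite leeDl// adde_ge0//; case: ifP.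
rewrite add0e; have [->|->] : l = n%:Z :> int \/ l = (- n%:Z)%R :> int by lia.
  by rewrite eqxx leeDl//; case: ifP.
by rewrite eqxx leeDr//; case: ifP.
Qed.

(** Use the bound [c] at the indices with [|l| < n], of which there are at most [2 n], and the bound
    [a] at all others. *)
Lemma mass_min a n (c : R) : (0 <= c)%R -> (forall l, 0 <= a l) ->
  mass (fun l => mine (a l) c%:E) <= (n%:R * (2 * c))%:E + tail a n.
Proof.
move=> c0 a0; apply: le_trans (leeD (mass_near n c0) (lexx _)).
rewrite -massD; last 2 first.
- by move=> l; case: ifP.
- exact: outer_ge0.
apply: le_mass => l; rewrite /outer ltnNge; case: (leqP n) => _ /=.
  by rewrite add0e ge_min lexx.
by rewrite adde0 ge_min lexx orbT.
Qed.

End envelopes.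

(** * Envelopes with weighted tail bounds *)

Section decaying_envelopes.
Context {R : realType} (rho : R).
Hypothesis rho_ge1 : 1 <= rho.
Implicit Types (a b : int -> \bar R).
Local Open Scope ereal_scope.

(** Tails [|l| >= 2^k] replace the dyadic shells because they behave well under convolution; for
    [rho > 1] a geometric series makes the two forms equivalent up to constants. The bound on the
    mass also controls the index [0], which lies in no such tail. *)
Definition decays a (alpha : R) : Prop := [/\ forall l, 0 <= a l,
  mass a <= alpha%:E & forall k, (rho ^+ k)%:E * tail a (2 ^ k) <= alpha%:E].

Let rhoX_ge0 k : 0 <= (rho ^+ k)%:E.
Proof. by rewrite lee_fin exprn_ge0// (le_trans ler01). Qed.

Lemma decays_ge0 a alpha : decays a alpha -> (0 <= alpha)%R.
Proof. by case=> a0 ta _; rewrite -lee_fin (le_trans _ ta)// mass_ge0. Qed.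

Lemma le_decays a b alpha beta : (forall l, 0 <= a l) -> (forall l, a l <= b l) ->
  (alpha <= beta)%R -> decays b alpha -> decays a beta.
Proof.
move=> a0 ab le_ab [b0 tb db]; split=> // [|k].
  by rewrite (le_trans (le_mass ab))// (le_trans tb).
rewrite (le_trans _ (le_trans (db k) _))// lee_wpmul2l//.
exact: le_tail.
Qed.

Lemma decaysD a b alpha beta : decays a alpha -> decays b beta ->
  decays (fun l => a l + b l) (alpha + beta).
Proof.
move=> [a0 ta da] [b0 tb db]; split=> [l||k]; first exact: adde_ge0.
  by rewrite massD// EFinD leeD.
by rewrite tailD// ge0_muleDr ?tail_ge0// EFinD leeD.
Qed.

Lemma decaysZ (c : R) a alpha : (0 <= c)%R -> decays a alpha ->
  decays (fun l => c%:E * a l) (c * alpha).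
Proof.
move=> c0 [a0 ta da]; split=> [l||k]; first by rewrite mule_ge0.
  by rewrite massZ// EFinM lee_wpmul2l.
by rewrite tailZ// muleCA EFinM lee_wpmul2l.
Qed.

Lemma decays0 : decays (fun=> 0) 0.
Proof.
split=> [//||k]; first by rewrite /mass esum1.
rewrite /tail /mass esum1 ?mule0// => l _.
by rewrite /outer; case: ifP.
Qed.

Lemma decays_delta : decays (fun l => if l == 0%R :> int then 1 else 0) 1.
Proof.
split=> [l||k]; first by case: ifP.
  by rewrite mass_delta.
rewrite /tail /mass esum1 ?mule0// => l _.
rewrite /outer; case: ifP => //; case: ifP => // /eqP ->.
by rewrite leqNgt expn_gt0.
Qed.

Lemma decays_opp a alpha : decays a alpha -> decays (fun l => a (- l)%R) alpha.
Proof.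
move=> [a0 ta da]; split=> [l//||k]; first by rewrite mass_opp.
rewrite /tail (_ : outer _ _ = fun l => outer (2 ^ k) a (- l)%R) ?mass_opp//.
by apply/funext => l; rewrite /outer abszN.
Qed.

(** The masses enter through their own bounds [ta] and [tb], so a small mass improves the estimate
    even when [alpha] and [beta] are large. The factor [rho] pays for the passage from level [k] of
    the factors to level [k.+1] of the convolution. *)
Lemma decays_convol a b alpha beta (ta tb : R) :
  decays a alpha -> decays b beta -> mass a <= ta%:E -> mass b <= tb%:E ->
  decays (convol a b) (rho * (alpha * tb + ta * beta)).
Proof.
move=> Da Db hta htb.
have [al0 be0] := (decays_ge0 Da, decays_ge0 Db).
case: Da Db => a0 ta' da [b0 tb' db].
have ta0 : (0 <= ta)%R by rewrite -lee_fin (le_trans (mass_ge0 a0)).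
have tb0 : (0 <= tb)%R by rewrite -lee_fin (le_trans (mass_ge0 b0)).
have rho0 : (0 <= rho)%R by rewrite (le_trans ler01).
have tc : mass (convol a b) <= (alpha * tb + ta * beta)%:E.
  rewrite mass_convol// EFinD EFinM.
  apply: (@le_trans _ _ (alpha%:E * tb%:E)); first by rewrite lee_pmul ?mass_ge0.
  by rewrite leeDl// lee_fin mulr_ge0.
have tc' : mass (convol a b) <= (rho * (alpha * tb + ta * beta))%:E.
  by rewrite (le_trans tc)// lee_fin ler_peMl// addr_ge0// mulr_ge0.
split=> //; first exact: convol_ge0.
case=> [|k].
  (* The radius [2^0] is not of the form [n + n], but at this level the weight is [1] and the mass
     is a sufficient bound. *)
  rewrite expr0 mul1e (le_trans _ tc')//.
  by apply: le_mass => l; rewrite /outer; case: ifP => // _; exact: convol_ge0.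
rewrite expnS mul2n -addnn.
apply: le_trans (lee_wpmul2l (rhoX_ge0 _) (tail_convol _ a0 b0)) _.
rewrite exprS EFinM -muleA [leRHS]EFinM lee_wpmul2l ?lee_fin//.
rewrite ge0_muleDr ?mule_ge0 ?tail_ge0 ?mass_ge0// EFinD !EFinM.
rewrite muleA [X in _ + X]muleCA leeD//; apply: lee_pmul => //;
  by rewrite ?mule_ge0 ?tail_ge0 ?mass_ge0.
Qed.

End decaying_envelopes.

(** * Matrices dominated along their diagonals *)

Section matrices.
Context {R : realType}.
Implicit Types (M N : zmatrix R) (x : int -> R[i]) (a b : int -> \bar R).

Definition mv M x : int -> R[i] := fun k => csum (fun l => M k l * x l).

Definition mmul M N : zmatrix R := fun k l => mv M (fun j => N j l) k.

Definition madd M N : zmatrix R := fun k l => M k l + N k l.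

Definition zscale (c : R) M : zmatrix R := fun k l => c%:C * M k l.

Definition mid : zmatrix R := fun k l => (k == l)%:R.

Definition adj M : zmatrix R := fun k l => conjc (M l k).

(** Entrywise comparison with the Laurent matrix of [a]; products of Laurent matrices correspond to
    convolutions. *)
Definition dominated M a : Prop := forall k l, ((normc (M k l))%:E <= a (k - l)%R)%E.

(** Without summability the right-hand side is [+oo]. Products can thus be estimated before any
    convergence is known. *)
Lemma normc_csum_esum (f : int -> R[i]) :
  ((normc (csum f))%:E <= \esum_(i in setT) (normc (f i))%:E)%E.
Proof.
have [sf|] := boolP (\esum_(i in setT) (normc (f i))%:E < +oo)%E.
  have {}sf := (csummableE f).2 sf; rewrite (nsumE (fun i => normc_ge0 (f i)) sf).
  by rewrite lee_fin; exact: normc_csum.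
by rewrite -leNgt leye_eq => /eqP ->; rewrite leey.
Qed.

Lemma dominated_adj M a : dominated M a -> dominated (adj M) (fun l => a (- l)).
Proof. by move=> Ma k l; rewrite /adj normc_conjc opprB. Qed.

Lemma reindex_opp_shift a (k : int) :
  (\esum_(l in setT) a (k - l)%R = mass a)%E.
Proof.
have bij : bijective (fun l : int => k - l).
  by exists (fun l : int => k - l) => l; rewrite opprB addrC subrK.
by rewrite [RHS]/mass (reindexT_esum a bij).
Qed.

Lemma dominated_row M a k : dominated M a ->
  (\esum_(l in setT) (normc (M k l))%:E <= mass a)%E.
Proof. by move=> Ma; rewrite -(reindex_opp_shift a k); apply: le_esum => l _. Qed.

Lemma dominated_csummable M a k : dominated M a -> (mass a < +oo)%E ->
  csummable (M k).
Proof.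
move=> Ma ta; apply: (csummableE _).2.
exact: le_lt_trans (dominated_row k Ma) ta.
Qed.

Lemma csummable_mv_term M a x (B : R) k : dominated M a -> (mass a < +oo)%E ->
  (forall l, normc (x l) <= B) -> csummable (fun l => M k l * x l).
Proof. by move=> Ma ta xB; apply: csummableM xB _; exact: dominated_csummable ta. Qed.

Lemma csummable_bounded x : csummable x -> exists B, forall l, normc (x l) <= B.
Proof.
move=> sx; exists (nsum (fun l => normc (x l))) => l.
have x0 i : (0 <= (normc (x i))%:E :> \bar R)%E by rewrite lee_fin normc_ge0.
rewrite -lee_fin -(nsumE (fun i => normc_ge0 (x i)) sx).
exact: (esum_ge_term (a := fun i => (normc (x i))%:E)).
Qed.

(** Young's inequality in [l^1]: after exchanging the sums, each column of the dominating matrix has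
    sum [mass a]. *)
Lemma csummable_mv M a x : (forall l, 0 <= a l)%E -> dominated M a ->
  (mass a < +oo)%E -> csummable x -> csummable (mv M x).
Proof.
move=> a0 Ma ta sx; apply: (csummableE _).2.
have x0 i : (0 <= (normc (x i))%:E :> \bar R)%E by rewrite lee_fin normc_ge0.
apply: (@le_lt_trans _ _ (mass a * \esum_(l in setT) (normc (x l))%:E)%E).
  rewrite -esumZ ?mass_ge0//.
  apply: (@le_trans _ _ (\esum_(k in setT) \esum_(l in setT)
      (a (k - l)%R * (normc (x l))%:E))%E).
    apply: le_esum => k _; apply: le_trans (normc_csum_esum _) _.
    by apply: le_esum => l _; rewrite normcM EFinM lee_wpmul2r.
  rewrite esum_swap; last by move=> i j; rewrite mule_ge0.
  apply: le_esum => l _; rewrite muleC -[X in (_ <= _ * X)%E](mass_shift _ l).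
  rewrite /mass -esumZ//.
  by apply: le_esum => k _; rewrite muleC.
have {}sx := (csummableE x).1 sx; rewrite lte_mul_pinfty ?mass_ge0//.
by rewrite ge0_fin_numE ?mass_ge0.
Qed.

Lemma dominated_mmul M N a b : dominated M a -> dominated N b ->
  (forall l, 0 <= a l)%E -> (forall l, 0 <= b l)%E -> dominated (mmul M N) (convol a b).
Proof.
move=> Ma Nb a0 b0 k l; apply: le_trans (normc_csum_esum _) _.
rewrite /convol -[leRHS](reindex_opp_shift (fun j => a j * b (k - l - j)%R)%E k).
apply: le_esum => j _; rewrite normcM EFinM.
have -> : k - l - (k - j) = j - l by ring.
by rewrite lee_pmul// lee_fin normc_ge0.
Qed.

(** Associativity is an exchange of sums; the double sum of [M k j * N j l * x l] is absolutely
    convergent, being bounded by [B * mass b * mass a]. Boundedness of [x] is enough, so the columns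
    of the inverse are allowed although their absolute summability is not yet known. *)
Lemma mv_mmul M N a b x (B : R) : dominated M a -> dominated N b ->
  (forall l, 0 <= a l)%E -> (forall l, 0 <= b l)%E ->
  (mass a < +oo)%E -> (mass b < +oo)%E -> (forall l, normc (x l) <= B) ->
  mv (mmul M N) x = mv M (mv N x).
Proof.
move=> Ma Nb a0 b0 ta tb xB; apply/funext => k.
have sN j : csummable (fun l => N j l * x l) by exact: csummable_mv_term tb xB.
have bN : exists c, forall j l, normc (N j l) <= c.
  exists (fine (mass b)) => j l; rewrite -lee_fin fineK ?ge0_fin_numE ?mass_ge0//.
  by apply: le_trans (Nb j l) _; exact: esum_ge_term.
have [c Nc] := bN.
have sMN l : csummable (fun j => M k j * N j l).
  by apply: (csummableM (B := c)) => //; exact: dominated_csummable ta.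
have B0 : 0 <= B by apply: le_trans (xB 0); exact: normc_ge0.
transitivity (csum (fun l => csum (fun j => M k j * N j l * x l))).
  congr csum; apply/funext => l; rewrite /mmul /mv mulrC -csumZ//.
  by congr csum; apply/funext => j; rewrite mulrC.
rewrite csum_swap.
  congr csum; apply/funext => j; rewrite /mv -csumZ//.
  by congr csum; apply/funext => l; rewrite mulrA.
rewrite esum_swap; last by move=> i j; rewrite lee_fin normc_ge0.
apply: (@le_lt_trans _ _ ((B%:E * mass b) * \esum_(j in setT) (normc (M k j))%:E)%E).
  rewrite -esumZ; last 2 first.
  - by rewrite mule_ge0 ?mass_ge0.
  - by move=> j; rewrite lee_fin normc_ge0.
  apply: le_esum => j _.
  rewrite -(reindex_opp_shift b j) -esumZ// muleC -esumZ; last 2 first.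
  - by rewrite lee_fin normc_ge0.
  - by move=> l; rewrite mule_ge0.
  apply: le_esum => l _; rewrite -mulrA !normcM !EFinM.
  rewrite lee_wpmul2l ?lee_fin ?normc_ge0// [leRHS]muleC.
  by rewrite lee_pmul// lee_fin ?normc_ge0.
have fb : mass b \is a fin_num by rewrite ge0_fin_numE ?mass_ge0.
rewrite lte_mul_pinfty ?mule_ge0 ?mass_ge0 ?fin_numM//.
exact: le_lt_trans (dominated_row k Ma) ta.
Qed.

Lemma mv_mid x : mv mid x = x.
Proof.
apply/funext => k; rewrite /mv (csum_term (j := k)).
  by rewrite /mid eqxx mul1r.
by move=> l lk; rewrite /mid eq_sym (negbTE lk) mul0r.
Qed.

Lemma mmul_mid M : mmul M mid = M.
Proof.
apply/funext => k; apply/funext => l; rewrite /mmul /mv (csum_term (j := l)).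
  by rewrite /mid eqxx mulr1.
by move=> j jl; rewrite /mid (negbTE jl) mulr0.
Qed.

Lemma mv_madd M N a b x (B : R) : dominated M a -> dominated N b ->
  (mass a < +oo)%E -> (mass b < +oo)%E -> (forall l, normc (x l) <= B) ->
  mv (madd M N) x = (fun k => mv M x k + mv N x k).
Proof.
move=> Ma Nb ta tb xB; apply/funext => k; rewrite /mv -csumD.
- by congr csum; apply/funext => l; rewrite mulrDl.
- exact: csummable_mv_term ta xB.
- exact: csummable_mv_term tb xB.
Qed.

Lemma mv_zscale c M a x (B : R) : dominated M a -> (mass a < +oo)%E ->
  (forall l, normc (x l) <= B) -> mv (zscale c M) x = (fun k => c%:C * mv M x k).
Proof.
move=> Ma ta xB; apply/funext => k; rewrite /mv -csumZ.
- by congr csum; apply/funext => l; rewrite mulrA.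
- exact: csummable_mv_term ta xB.
Qed.

Lemma mv_addr M a x y (B B' : R) : dominated M a -> (mass a < +oo)%E ->
  (forall l, normc (x l) <= B) -> (forall l, normc (y l) <= B') ->
  mv M (fun l => x l + y l) = (fun k => mv M x k + mv M y k).
Proof.
move=> Ma ta xB yB; apply/funext => k; rewrite /mv -csumD.
- by congr csum; apply/funext => l; rewrite mulrDr.
- exact: csummable_mv_term ta xB.
- exact: csummable_mv_term ta yB.
Qed.

End matrices.

(** * The class of decaying matrices and its products *)

Section decaying_matrices.
Context {R : realType} (rho : R).
Hypothesis rho_ge1 : 1 <= rho.
Implicit Types (M N : zmatrix R).

Definition mdecays M (alpha : R) : Prop :=
  exists2 a, decays rho a alpha & dominated M a.

Lemma mdecays_ge0 M alpha : mdecays M alpha -> 0 <= alpha.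
Proof. by move=> [a /decays_ge0]. Qed.

Lemma decays_lty a alpha : decays rho a alpha -> (mass a < +oo)%E.
Proof. by move=> [_ ta _]; exact: le_lt_trans ta (ltry _). Qed.

Lemma mdecays_entry M alpha : mdecays M alpha -> forall k l, normc (M k l) <= alpha.
Proof.
move=> [a [a0 ta _] Ma] k l; rewrite -lee_fin (le_trans (Ma k l))//.
by rewrite (le_trans _ ta)//; exact: esum_ge_term.
Qed.

Lemma mdecaysD M N alpha beta : mdecays M alpha -> mdecays N beta ->
  mdecays (madd M N) (alpha + beta).
Proof.
move=> [a da Ma] [b db Nb]; exists (fun l => a l + b l)%E; first exact: decaysD.
move=> k l; rewrite /madd (le_trans _ (leeD (Ma k l) (Nb k l)))//.
by rewrite -EFinD lee_fin le_normcD.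
Qed.

Lemma mdecaysZ (c : R) M alpha : mdecays M alpha -> mdecays (zscale c M) (`|c| * alpha).
Proof.
move=> [a da Ma]; exists (fun l => `|c|%:E * a l)%E; first exact: decaysZ.
by move=> k l; rewrite /zscale normcM normc_real EFinM lee_wpmul2l.
Qed.

Lemma mdecays_mid : mdecays (mid : zmatrix R) 1.
Proof.
exists (fun l : int => if l == 0%R :> int then 1 else 0)%E; first exact: decays_delta.
move=> k l; rewrite /mid subr_eq0; case: eqVneq => _; first by rewrite normc1.
by rewrite normc0.
Qed.

Lemma mdecays_adj M alpha : mdecays M alpha -> mdecays (adj M) alpha.
Proof.
move=> [a da Ma]; exists (fun l => a (- l)%R); first exact: decays_opp.
exact: dominated_adj.
Qed.

Lemma mdecays_mmul M N alpha beta : mdecays M alpha -> mdecays N beta ->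
  mdecays (mmul M N) (2 * rho * alpha * beta).
Proof.
move=> [a da Ma] [b db Nb]; exists (convol a b).
  have [_ ta _] := da; have [_ tb _] := db.
  have -> : 2 * rho * alpha * beta = rho * (alpha * beta + alpha * beta) by ring.
  exact: decays_convol.
by apply: dominated_mmul => //; [case: da|case: db].
Qed.

(* Interpolation: an envelope may be truncated at a uniform bound of the entries. *)
Lemma mdecays_sqr M alpha (e : R) n : mdecays M alpha ->
  (forall k l, normc (M k l) <= e) ->
  mdecays (mmul M M) (2 * rho * alpha * ((2 ^ n)%:R * (2 * e) + alpha / rho ^+ n)).
Proof.
move=> [a da Ma] Me; have [a0 ta tla] := da.
have e0 : 0 <= e by apply: le_trans (Me 0 0); exact: normc_ge0.
pose a' l := mine (a l) e%:E.
have a'0 l : (0 <= a' l)%E by rewrite /a' le_min a0 lee_fin.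
have da' : decays rho a' alpha.
  by apply: (le_decays rho_ge1 a'0 _ (lexx alpha) da) => l; rewrite /a' ge_min lexx.
have Ma' : dominated M a' by move=> k l; rewrite /a' le_min Ma lee_fin Me.
have rn : 0 < rho ^+ n by rewrite exprn_gt0// (lt_le_trans ltr01).
have ta' : (mass a' <= ((2 ^ n)%:R * (2 * e) + alpha / rho ^+ n)%:E)%E.
  apply: le_trans (mass_min (2 ^ n) e0 a0) _; rewrite EFinD; apply: leeD => //.
  by rewrite mulrC EFinM lee_pdivlMl.
exists (convol a' a'); last exact: dominated_mmul.
set s := _ + _ / _ in ta' *.
have -> : 2 * rho * alpha * s = rho * (alpha * s + s * alpha) by ring.
exact: decays_convol.
Qed.

End decaying_matrices.

(** * Energy, inner product and adjoints *)

Section energy.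
Context {R : realType}.
Implicit Types (M : zmatrix R) (x y w : int -> R[i]).

(** Energies are compared on absolutely summable sequences. Decaying matrices preserve these, and
    the unit vectors, on which operator bounds are finally tested, are among them. *)
Definition energy x : R := nsum (fun k => normc (x k) ^+ 2).

Definition inner x y : R[i] := csum (fun k => conjc (x k) * y k).

Lemma csummable_inner x y : csummable x -> csummable y ->
  csummable (fun k => conjc (x k) * y k).
Proof.
move=> sx sy; have [B yB] := csummable_bounded sy.
apply: (csummableM (B := B)) => //.
by apply: le_csummable sx => k; rewrite normc_conjc.
Qed.

Lemma rsummable_sqr x : csummable x -> rsummable (fun k => normc (x k) ^+ 2).
Proof.
move=> sx; apply: (le_rsummable (g := fun k => normc (conjc (x k) * x k))).
  by move=> k; rewrite normcM normc_conjc ger0_norm ?sqr_ge0// expr2.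
exact: csummable_inner.
Qed.

Lemma l2energyE x : csummable x -> l2energy x = (energy x)%:E.
Proof. by move=> sx; apply: nsumE (rsummable_sqr sx) => k; exact: sqr_ge0. Qed.

Lemma energy_ge0 x : 0 <= energy x.
Proof. by apply: nsum_ge0 => k; exact: sqr_ge0. Qed.

Lemma entry_energy x k : csummable x -> normc (x k) ^+ 2 <= energy x.
Proof.
move=> sx; rewrite -lee_fin -l2energyE//.
apply: (esum_ge_term (a := fun k => (normc (x k) ^+ 2)%:E)) => // l.
by rewrite lee_fin sqr_ge0.
Qed.

Let normc_unit (k l : int) : normc ((k == l)%:R : R[i]) = (k == l)%:R.
Proof. by case: eqP => _; rewrite ?normc1 ?normc0. Qed.

Let mass_unit (l : int) : mass (fun k => (k == l)%:R%:E : \bar R) = 1%E.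
Proof.
rewrite -[RHS](mass_delta l)//; congr mass; apply/funext => k.
by case: eqP.
Qed.

Lemma csummable_unit (l : int) : csummable (fun k : int => (k == l)%:R : R[i]).
Proof.
apply: (csummableE _).2; rewrite (_ : esum _ _ = 1%E) ?ltry// -(mass_unit l).
by apply: eq_esum => k _; rewrite normc_unit.
Qed.

Lemma energy_unit (l : int) : energy (fun k : int => (k == l)%:R) = 1.
Proof.
apply: EFin_inj; rewrite -l2energyE; last exact: csummable_unit.
rewrite -[RHS](mass_unit l); apply: eq_esum => k _.
by rewrite normc_unit; case: eqP => _; rewrite ?expr1n ?expr0n.
Qed.

Lemma inner_energy x : csummable x -> inner x x = (energy x)%:C.
Proof.
move=> sx; rewrite -csum_real; [|by move=> k; exact: sqr_ge0|exact: rsummable_sqr].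
by congr csum; apply/funext => k; rewrite mulrC mul_conjc.
Qed.

Lemma innerJ x y : inner y x = conjc (inner x y).
Proof.
rewrite /inner -csumJ; congr csum; apply/funext => k.
by rewrite rmorphM /= conjcK mulrC.
Qed.

Lemma csummable_subZ (c : R) x w : csummable x -> csummable w ->
  csummable (fun k => x k - c%:C * w k).
Proof.
move=> sx sw; have -> : (fun k => x k - c%:C * w k) = (fun k => x k + (- c%:C) * w k).
  by apply/funext => k; rewrite mulNr.
by apply: csummableD => //; exact: csummableZ.
Qed.

(** The square is expanded; the two cross terms agree because [inner w x] is real. *)
Lemma energy_subZ (c e : R) x w : csummable x -> csummable w ->
  inner w x = e%:C ->
  energy (fun k => x k - c%:C * w k) = energy x - 2 * c * e + c ^+ 2 * energy w.
Proof.
move=> sx sw wx.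
have xw : inner x w = e%:C by rewrite innerJ wx conjc_real.
apply: (@complexI R).
rewrite -[LHS]inner_energy; last exact: csummable_subZ.
have -> : inner (fun k => x k - c%:C * w k) (fun k => x k - c%:C * w k) =
    csum (fun k => (conjc (x k) * x k - c%:C * (conjc (w k) * x k)) -
      (c%:C * (conjc (x k) * w k) - c%:C * (c%:C * (conjc (w k) * w k)))).
  congr csum; apply/funext => k.
  have -> : conjc (x k - c%:C * w k) = conjc (x k) - c%:C * conjc (w k).
    by rewrite rmorphB rmorphM -[in RHS](conjc_real c).
  by ring.
have [s1 s2] := (csummable_inner sw sx, csummable_inner sx sw).
have [s3 s4] := (csummable_inner sx sx, csummable_inner sw sw).
rewrite csumB; [|by apply: csummableB => //; exact: csummableZ|
  by apply: csummableB; do 2?exact: csummableZ; apply: csummableZ; exact: csummableZ].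
rewrite csumB//; last exact: csummableZ.
rewrite csumB; [|exact: csummableZ|by apply: csummableZ; exact: csummableZ].
rewrite !csumZ//; last exact: csummableZ.
rewrite -!/(inner _ _) wx xw !inner_energy//.
rewrite !(rmorphD, rmorphB, rmorphM, rmorphXn) /= rmorphN /= !rmorphM/= rmorph_nat.
ring.
Qed.

(** Fubini's theorem: as [y] is bounded, [x] absolutely summable and every row of [M] has moduli of
    sum at most [mass a], the double sum converges absolutely. *)
Lemma inner_adj M a x y : dominated M a -> (forall l, 0 <= a l)%E ->
  (mass a < +oo)%E -> csummable x -> csummable y ->
  inner (mv (adj M) x) y = inner x (mv M y).
Proof.
move=> Ma a0 ta sx sy; have [B yB] := csummable_bounded sy.
have [Bx xB] := csummable_bounded sx.
have Ma' := dominated_adj Ma.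
have ta' : (mass (fun l => a (- l)%R) < +oo)%E by rewrite mass_opp.
transitivity (csum (fun k => csum (fun j => M j k * conjc (x j) * y k))).
  congr csum; apply/funext => k; rewrite /mv -csumJ mulrC -csumZ.
    by congr csum; apply/funext => j; rewrite rmorphM /adj /= conjcK mulrC.
  apply: le_csummable (csummable_mv_term k Ma' ta' xB) => j.
  by rewrite normc_conjc.
rewrite csum_swap.
  congr csum; apply/funext => j; rewrite /mv -csumZ.
    by congr csum; apply/funext => k; ring.
  exact: csummable_mv_term yB.
have B0 : 0 <= B by apply: le_trans (yB 0); exact: normc_ge0.
have x0 i : (0 <= (normc (x i))%:E :> \bar R)%E by rewrite lee_fin normc_ge0.
rewrite esum_swap; last by move=> i j; rewrite lee_fin normc_ge0.
apply: (@le_lt_trans _ _ ((mass a * B%:E) * \esum_(j in setT) (normc (x j))%:E)%E).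
  rewrite -esumZ//; last by rewrite mule_ge0// mass_ge0.
  apply: le_esum => j _.
  rewrite -(reindex_opp_shift a j) -muleA muleC -esumZ//; last by rewrite mule_ge0.
  apply: le_esum => k _; rewrite !normcM normc_conjc !EFinM.
  rewrite -muleA [X in (X <= _)%E]muleC; apply: lee_pmul => //.
  - by rewrite mule_ge0// lee_fin normc_ge0.
  - by rewrite lee_fin normc_ge0.
  - by rewrite muleC lee_wpmul2r// lee_fin.
have fa : mass a \is a fin_num by rewrite ge0_fin_numE ?mass_ge0.
rewrite lte_mul_pinfty ?mule_ge0 ?mass_ge0 ?fin_numM//.
exact: (csummableE x).1.
Qed.

End energy.

(** * Contraction by [1 - A^* A / mu] *)

Section richardson.
Context {R : realType} (A : zmatrix R) (a : int -> \bar R) (mu kappa : R).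
Hypotheses (Aa : dominated A a) (a0 : forall l, (0 <= a l)%E) (ta : (mass a < +oo)%E).
Hypotheses (mu_ge1 : 1 <= mu) (kappa_ge1 : 1 <= kappa).
Hypothesis energy_le : forall x, csummable x -> energy (mv A x) <= mu * energy x.
Hypothesis energy_ge : forall x, csummable x -> energy x <= kappa * energy (mv A x).

Let a'0 : (forall l, 0 <= a (- l)%R)%E. Proof. by move=> l. Qed.

Let Aa' : dominated (adj A) (fun l => a (- l)).
Proof. exact: dominated_adj. Qed.

Let ta' : (mass (fun l => a (- l)%R) < +oo)%E.
Proof. by rewrite mass_opp. Qed.

(* Expand [0 <= energy (mu z - A w)] with [w = A^* z]. *)
Lemma energy_adj_le z : csummable z -> energy (mv (adj A) z) <= mu * energy z.
Proof.
move=> sz; set w := mv (adj A) z.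
have sw : csummable w by exact: csummable_mv Aa' ta' sz.
have sAw : csummable (mv A w) by exact: csummable_mv Aa ta sw.
have mu0 : 0 < mu by rewrite (lt_le_trans ltr01).
have wz : inner (mv A w) z = (energy w)%:C.
  by rewrite innerJ -(inner_adj Aa a0 ta sz sw) -/w inner_energy// conjc_real.
have := energy_ge0 (fun k => z k - (mu^-1)%:C * mv A w k).
rewrite (energy_subZ _ sz sAw wz) => h.
have h1 := energy_le sw.
have h2 : mu^-1 ^+ 2 * energy (mv A w) <= mu^-1 * energy w.
  rewrite expr2 -mulrA; apply: ler_wpM2l; first by rewrite invr_ge0 ltW.
  by rewrite ler_pdivrMl.
rewrite -ler_pdivrMl//.
by move: h h2; set p := mu^-1 * energy w; rewrite -mulrA -/p; lra.
Qed.

(** With [w = A^* A x], the left-hand side is [energy x - 2 / mu * energy (A x) + energy w / mu^2].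
    Since [energy w <= mu * energy (A x)], it is at most [energy x - energy (A x) / mu], and the
    lower bound on [A] concludes. *)
Lemma richardson_contraction x : csummable x ->
  energy (fun k => x k - (mu^-1)%:C * mv (adj A) (mv A x) k) <=
  (1 - (mu * kappa)^-1) * energy x.
Proof.
move=> sx.
have sAx : csummable (mv A x) by exact: csummable_mv Aa ta sx.
have mu0 : 0 < mu by rewrite (lt_le_trans ltr01).
have ka0 : 0 < kappa by rewrite (lt_le_trans ltr01).
have sw : csummable (mv (adj A) (mv A x)) by exact: csummable_mv Aa' ta' sAx.
have wx : inner (mv (adj A) (mv A x)) x = (energy (mv A x))%:C.
  by rewrite (inner_adj Aa a0 ta sAx sx) inner_energy.
rewrite (energy_subZ _ sx sw wx).
have h1 := energy_adj_le sAx.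
have h2 : mu^-1 ^+ 2 * energy (mv (adj A) (mv A x)) <= mu^-1 * energy (mv A x).
  rewrite expr2 -mulrA; apply: ler_wpM2l; first by rewrite invr_ge0 ltW.
  by rewrite ler_pdivrMl.
have h3 : (mu * kappa)^-1 * energy x <= mu^-1 * energy (mv A x).
  rewrite invfM -mulrA; apply: ler_wpM2l; first by rewrite invr_ge0 ltW.
  by rewrite ler_pdivrMl// energy_ge.
rewrite mulrBl mul1r; lra.
Qed.

End richardson.

(** * A quadratic recursion with doubly exponential gain *)

Section doubling_recursion.
Context {R : realType}.

Lemma small_power (x e : R) : 0 <= x < 1 -> 0 < e -> exists n, x ^+ n < e.
Proof.
move=> /andP[x0 x1] e0.
have := @cvg_expr R x; rewrite ger0_norm// => /(_ x1)/cvgrPdist_lt/(_ e e0)[n _ /(_ n)].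
rewrite /= leqnn sub0r normrN ger0_norm ?exprn_ge0// => /(_ isT) h.
by exists n.
Qed.

(* [1 + b] is at most of order [s ^ 2^j] for some [s]; as long as [s > 1], the
   recursion lets one replace [s] by [s * Num.sqrt nu], so after finitely many
   steps [b] is bounded, and then one more step makes it tend to [0]. *)
Lemma doubling_recursion_small (C nu : R) (b : nat -> R) :
  0 <= C -> 0 < nu < 1 -> (forall j, 0 <= b j) ->
  (forall j, b j.+1 <= C * b j * ((2 + b j) * nu ^+ (2 ^ j))) ->
  forall e, 0 < e -> exists j, b j < e.
Proof.
move=> C0 /andP[nu0 nu1] b0 bS e e0.
(* As [b j * (2 + b j) <= 2 * u j ^+ 2], the recursion becomes purely quadratic in [u], which is
   moreover at least [1]. *)
pose u j := 1 + b j; have u1 j : 1 <= u j by rewrite lerDl.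
have u0 j : 0 <= u j by exact: le_trans (u1 j).
have nuX j : 0 <= nu ^+ j <= 1 by rewrite exprn_ge0 ?exprn_ile1 ?ltW.
have bu j : b j.+1 <= 2 * C * u j ^+ 2 * nu ^+ (2 ^ j).
  apply: le_trans (bS j) _; have /andP[nX _] := nuX (2 ^ j)%N.
  rewrite mulrA ler_wpM2r// -mulrA (mulrC 2) -mulrA ler_wpM2l//.
  by have := b0 j; rewrite /u expr2; nra.
pose P s := exists K, forall j, u j <= K * s ^+ (2 ^ j).
have P_le s s' : 0 <= s -> s <= s' -> P s -> P s'.
  move=> s0 ss' [K hK]; exists K => j; apply: le_trans (hK j) _.
  have K0 : 0 <= K.
    have := hK 0%N; rewrite expr1; have := u1 0%N.
    by move: s0; rewrite le_eqVlt => /orP[/eqP <-|sp]; [lra|nra].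
  by rewrite ler_wpM2l// lerXn2r// nnegrE// (le_trans s0).
(* Ignoring the gain, [u j.+1 <= D * u j ^+ 2], so [D * u j] is at most squared at each step. This
   gives a first base [s] with [P s]. *)
pose D := 1 + 2 * C.
have D1 : 1 <= D by rewrite lerDl mulr_ge0.
have P0 : P (D * u 0%N).
  exists 1 => j; rewrite mul1r; apply: (@le_trans _ _ (D * u j)).
    by rewrite ler_peMl.
  elim: j => [|j IH]; first by rewrite expr1.
  rewrite expnSr exprM; apply: (@le_trans _ _ ((D * u j) ^+ 2)); last first.
    by rewrite lerXn2r// nnegrE ?exprn_ge0// mulr_ge0// (le_trans ler01).
  rewrite exprMn expr2 -mulrA; apply: ler_wpM2l; first exact: le_trans D1.
  have /andP[nX0 nX1] := nuX (2 ^ j)%N.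
  have h : b j.+1 <= 2 * C * u j ^+ 2.
    by apply: le_trans (bu j) _; rewrite ler_piMr// mulr_ge0 ?sqr_ge0// mulr_ge0.
  have h2 : 1 <= u j ^+ 2 by rewrite exprn_ege1.
  by rewrite {1}/u /D mulrDl mul1r; lra.
(* The gain [nu ^+ (2 ^ j)] acquired in passing to level [j.+1] equals [m ^+ (2 ^ j.+1)], which
   multiplies the base by [m]. *)
pose m := Num.sqrt nu.
have m0 : 0 <= m by exact: sqrtr_ge0.
have m2 : m ^+ 2 = nu by rewrite sqr_sqrtr// ltW.
have m1 : m < 1 by rewrite -sqrtr1 ltr_sqrt.
have P_step s : 1 <= s -> P s -> P (Num.max 1 (s * m)).
  move=> s1 [K hK]; set t := Num.max 1 _.
  have t1 : 1 <= t by rewrite le_max lexx.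
  have t0 : 0 <= t by exact: le_trans t1.
  have CK : 0 <= 2 * C * K ^+ 2 by rewrite mulr_ge0 ?sqr_ge0// mulr_ge0.
  (* The summand [u 0] serves the index [0], the rest the successors, where the [1] accounts for
     [u = 1 + b]. *)
  exists (u 0%N + (1 + 2 * C * K ^+ 2)) => -[|j].
    rewrite expr1 (@le_trans _ _ (u 0%N * t))//; first by rewrite ler_peMr.
    by rewrite ler_wpM2r// lerDl addr_ge0.
  have h : b j.+1 <= 2 * C * K ^+ 2 * t ^+ (2 ^ j.+1).
    apply: le_trans (bu j) _; rewrite -(mulrA _ (u j ^+ 2)) -(mulrA _ (K ^+ 2)).
    apply: ler_wpM2l; first by rewrite mulr_ge0.
    apply: (@le_trans _ _ ((K * s ^+ (2 ^ j)) ^+ 2 * nu ^+ (2 ^ j))).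
      apply: ler_wpM2r; first by case/andP: (nuX (2 ^ j)%N).
      by rewrite lerXn2r// nnegrE// (le_trans (u0 j)).
    rewrite exprMn -mulrA; apply: ler_wpM2l; first exact: sqr_ge0.
    rewrite -m2 -!exprM [(2 * _)%N]mulnC -expnSr -exprMn.
    by rewrite lerXn2r// ?nnegrE// ?mulr_ge0// ?(le_trans ler01)// le_max lexx orbT.
  have tX : 1 <= t ^+ (2 ^ j.+1) by rewrite exprn_ege1.
  rewrite {1}/u; apply: (@le_trans _ _ ((1 + 2 * C * K ^+ 2) * t ^+ (2 ^ j.+1))).
    by rewrite mulrDl mul1r; lra.
  by rewrite ler_wpM2r ?lerDr// (le_trans ler01).
pose s0 := D * u 0%N.
have s01 : 1 <= s0 by rewrite mulr_ege1.
have P_iter i : P (Num.max 1 (s0 * m ^+ i)).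
  elim: i => [|i IH]; first by rewrite expr0 mulr1 (max_idPr s01).
  have le1 : 1 <= Num.max 1 (s0 * m ^+ i) by rewrite le_max lexx.
  apply: P_le (P_step _ le1 IH); first by rewrite le_max ler01.
  rewrite ge_max; apply/andP; split; first by rewrite le_max lexx.
  rewrite maxr_pMl// mul1r ge_max !le_max (ltW m1) /=.
  by rewrite exprSr mulrA lexx orbT.
(* After [i] improvements the base has fallen to [1], that is, [u] is bounded by some [K]. *)
have [i hi] : exists i, m ^+ i < s0^-1.
  by apply: small_power; rewrite ?m0// invr_gt0 (lt_le_trans ltr01).
have [K hK] : P 1.
  apply: P_le (P_iter i); first by rewrite le_max ler01.
  rewrite ge_max lexx /=.
  by rewrite ltW// -ltr_pdivlMl ?mulr1// (lt_le_trans ltr01).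
have CK : 0 <= 2 * C * K ^+ 2 by rewrite mulr_ge0 ?sqr_ge0// mulr_ge0.
have [n hn] : exists n, nu ^+ n < e / (1 + 2 * C * K ^+ 2).
  by apply: small_power; rewrite ?ltW ?nu0 ?nu1// divr_gt0// ltr_wpDr.
exists n.+1; apply: le_lt_trans (bu n) _.
have h1 : u n ^+ 2 <= K ^+ 2.
  by rewrite lerXn2r ?nnegrE ?(le_trans (u0 n))//; have := hK n; rewrite expr1n mulr1.
have h2 : nu ^+ (2 ^ n) <= nu ^+ n.
  by apply: ler_wiXn2l; [exact: ltW|exact: ltW|exact/ltnW/ltn_expl].
move: hn; rewrite ltr_pdivlMr ?ltr_wpDr// => hn; apply: le_lt_trans hn.
have /andP[nX0 _] := nuX (2 ^ n)%N; have /andP[nn0 _] := nuX n.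
rewrite [leRHS]mulrC; apply: ler_pM => //.
  by rewrite mulr_ge0 ?sqr_ge0// mulr_ge0.
apply: (@le_trans _ _ (2 * C * K ^+ 2)); last by rewrite lerDr.
by rewrite ler_wpM2l// mulr_ge0.
Qed.

End doubling_recursion.

(** * Neumann iteration for the diagonal suprema *)

Section approximate_fixed_point.
Context {R : realType}.
Implicit Types (a : int -> \bar R).

(** The error is uniform in [l] but may have infinite mass. It is therefore made small over a finite
    set of indices first, and the supremum over finite sets is taken last. *)
Lemma mass_le_limit a (w : nat -> int -> \bar R) (L c : R) : 0 <= L ->
  (forall n l, 0 <= w n l)%E ->
  (forall n l, a l <= w n l + (L * 2^-1 ^+ n)%:E)%E ->
  (forall n, mass (w n) <= c%:E)%E -> (mass a <= c%:E)%E.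
Proof.
move=> L0 w0 aw wc; apply: ge_ereal_sup => _ [F [finF _] <-].
apply/lee_addgt0Pr => e e0.
rewrite fsbig_finite//=; set s := fset_set F.
have bound (n : nat) (t : seq int) : (\sum_(l <- t) a l <=
    \sum_(l <- t) w n l + ((size t)%:R * (L * 2^-1 ^+ n))%:E)%E.
  elim: t => [|l t IH]; first by rewrite !big_nil mul0r adde0.
  rewrite !big_cons /= -natr1 mulrDl mul1r EFinD.
  apply: le_trans (leeD (aw n l) IH) _.
  by rewrite addeACA [X in (_ + X <= _)%E]addeC.
(* The added [1] keeps the denominator positive when [s] is empty or [L = 0]. *)
have [n hn] : exists n, 2^-1 ^+ n < e / ((size s)%:R * L + 1) :> R.
  apply: small_power; first by apply/andP; split; lra.
  by rewrite divr_gt0// ltr_wpDl// mulr_ge0.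
apply: le_trans (bound n s) _; apply: leeD.
  apply: le_trans (wc n); rewrite -[leLHS](_ : \sum_(l \in F) w n l = _)%E.
    by apply: ereal_sup_ubound; exists F.
  by rewrite fsbig_finite.
move: hn; rewrite lee_fin ltr_pdivlMr ?ltr_wpDl ?mulr_ge0// => hn.
rewrite mulrA mulrC (le_trans _ (ltW hn))// ler_wpM2l ?exprn_ge0 ?invr_ge0//.
by rewrite lerDl.
Qed.

Lemma decays_le_limit (rho : R) a (w : nat -> int -> \bar R) (L alpha : R) :
  0 < rho -> 0 <= L -> (forall l, 0 <= a l)%E ->
  (forall n l, a l <= w n l + (L * 2^-1 ^+ n)%:E)%E ->
  (forall n, decays rho (w n) alpha) -> decays rho a alpha.
Proof.
move=> rho0 L0 a0 aw dw; have w0 n l : (0 <= w n l)%E by case: (dw n).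
split=> // [|k].
  by apply: (mass_le_limit L0 w0 aw) => n; case: (dw n).
have rk : 0 < rho ^+ k by rewrite exprn_gt0.
rewrite -lee_pdivlMl// -EFinM /tail.
apply: (mass_le_limit (w := fun n => outer (2 ^ k) (w n)) L0).
- by move=> n; exact: outer_ge0.
- move=> n l; rewrite /outer; case: ifP => // _.
  by rewrite add0e lee_fin mulr_ge0// exprn_ge0.
- by move=> n; have [_ _] := dw n; rewrite EFinM lee_pdivlMl//; apply.
Qed.

Lemma dominated_diag_sup (Y : zmatrix R) : dominated Y (diag_sup Y).
Proof.
move=> k l; apply: ereal_sup_ubound; exists k => //.
by rewrite opprB addrC subrK.
Qed.

(** Together with [dominated_diag_sup], this makes [diag_sup Y] the least envelope of [Y]. *)
Lemma diag_sup_le (Y : zmatrix R) a l : dominated Y a -> (diag_sup Y l <= a l)%E.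
Proof.
move=> Ya; apply: ge_ereal_sup => _ [m _ <-].
by apply: le_trans (Ya _ _) _; rewrite opprB addrC subrK.
Qed.

Lemma diag_sup_ge0 (Y : zmatrix R) l : (0 <= diag_sup Y l)%E.
Proof.
apply: le_trans (ereal_sup_ubound (_ : range _ (normc (Y 0 (0 - l)))%:E)).
  by rewrite lee_fin normc_ge0.
by exists 0.
Qed.

(* Iterating [diag_sup Y <= convol z (diag_sup Y) + g] bounds [diag_sup Y] by
   the partial Neumann sums of [z] applied to [g], up to an error [L / 2 ^ n]. *)
Lemma mdecays_fixed_point (rho : R) (Y Z G : zmatrix R) (zeta gamma L : R) :
  1 <= rho -> (forall k l, normc (Y k l) <= L) ->
  mdecays rho Z zeta -> 2 * rho * zeta <= 2^-1 -> mdecays rho G gamma ->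
  Y = madd (mmul Z Y) G -> mdecays rho Y (2 * gamma).
Proof.
move=> rho1 YL [z dz Zz] zs [g dg Gg] YE.
have gamma0 := decays_ge0 dg; have zeta0 := decays_ge0 dz.
have [z0 mz _] := dz; have [g0 _ _] := dg.
have L0 : 0 <= L by apply: le_trans (YL 0 0); exact: normc_ge0.
pose d := diag_sup Y; have d0 : forall l, (0 <= d l)%E by exact: diag_sup_ge0.
have dL l : (d l <= L%:E)%E.
  by apply: ge_ereal_sup => _ [m _ <-]; rewrite lee_fin.
have dd l : (d l <= convol z d l + g l)%E.
  apply: (diag_sup_le (a := fun l => convol z d l + g l)%E).
  rewrite {1}YE => i j; rewrite /madd.
  apply: (@le_trans _ _ ((normc (mmul Z Y i j))%:E + (normc (G i j))%:E)%E).
    by rewrite -EFinD lee_fin le_normcD.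
  apply: leeD => //.
  by apply: (dominated_mmul Zz (dominated_diag_sup Y)).
pose w := fix w n := if n is n'.+1 then fun l => (convol z (w n') l + g l)%E
                     else fun=> 0%E : \bar R.
(* The constant [2 * gamma] is preserved by the iteration because [2 * rho * zeta * (2 * gamma) +
   gamma <= 2 * gamma]. *)
have dw n : decays rho (w n) (2 * gamma).
  elim: n => [|n IH] /=.
    apply: (le_decays rho1 _ _ _ (decays0 rho)) => //.
    by rewrite mulr_ge0.
  have [_ mw _] := IH.
  apply: (le_decays rho1 _ _ _ (decaysD (decays_convol rho1 dz IH mz mw) dg)) => //.
    by move=> l; rewrite adde_ge0// convol_ge0//; case: IH.
  nra.
exists d; last exact: dominated_diag_sup.
apply: (decays_le_limit (w := w) (L := L)) => //; first exact: lt_le_trans rho1.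
elim=> [|n IH] l; first by rewrite /= add0e expr0 mulr1.
have w0 : forall l, (0 <= w n l)%E by case: (dw n).
set c := L * 2^-1 ^+ n in IH.
have c0 : 0 <= c by rewrite mulr_ge0// exprn_ge0.
apply: le_trans (dd l) _ => /=.
rewrite -addeA [(g l + _)%E]addeC addeA leeD2r//.
apply: (@le_trans _ _ (convol z (fun l => w n l + c%:E)%E l)).
  by apply: le_convol => // i.
rewrite /convol.
under eq_esum => j _ do rewrite ge0_muleDr//.
rewrite esumD; [|by move=> j _; rewrite mule_ge0..].
(* Convolving [z] with the constant [c] gives [c * mass z], and [mass z <= zeta <= 1/2] halves the
   error. *)
rewrite leeD2l//; under eq_esum do rewrite muleC.
have -> : (L * 2^-1 ^+ n.+1)%:E = (c%:E * (2^-1)%:E)%E.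
  by rewrite -EFinM exprS /c; congr EFin; ring.
rewrite esumZ//.
apply: lee_wpmul2l; first by rewrite lee_fin.
apply: (le_trans mz); rewrite lee_fin.
by nra.
Qed.

End approximate_fixed_point.

(** * Powers with small decay constant *)

Section iterated_squaring.
Context {R : realType} (rho : R) (Y : zmatrix R) (L : R).
Hypotheses (rho_gt1 : 1 < rho) (Y_bounded : forall k l, normc (Y k l) <= L).

Let rho1 : 1 <= rho. Proof. exact: ltW. Qed.

(* [theta] bounds the square of the operator norm of [Z]. *)
Definition reduces (Z : zmatrix R) (theta alpha : R) : Prop :=
  [/\ mdecays rho Z alpha,
      forall x, csummable x -> energy (mv Z x) <= theta * energy x &
      exists G gamma, mdecays rho G gamma /\ Y = madd (mmul Z Y) G].

Lemma le_reduces Z theta theta' alpha : theta <= theta' ->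
  reduces Z theta alpha -> reduces Z theta' alpha.
Proof.
move=> tt' [dZ eZ gZ]; split=> // x sx.
by apply: le_trans (eZ x sx) _; rewrite ler_wpM2r// energy_ge0.
Qed.

(** Inserting [Y = Z' Y + G'] into [Y = Z Y + G] gives [Y = (Z Z') Y + (Z G' + G)]. The constant
    [beta] of the product is left free so that the sharper bound of [mdecays_sqr] can be
    supplied. *)
Lemma reduces_mmul Z Z' theta theta' alpha alpha' beta : 0 <= theta ->
  reduces Z theta alpha -> reduces Z' theta' alpha' ->
  mdecays rho (mmul Z Z') beta -> reduces (mmul Z Z') (theta * theta') beta.
Proof.
move=> th0 [dZ eZ [G [gamma [dG YG]]]] [dZ' eZ' [G' [gamma' [dG' YG']]]] dZZ.
have [a da Za] := dZ; have [a' da' Za'] := dZ'.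
have [ta ta'] := (decays_lty da, decays_lty da').
have [a0 _ _] := da; have [a'0 _ _] := da'.
split=> // [x sx|].
  have [B xB] := csummable_bounded sx.
  rewrite (mv_mmul Za Za' a0 a'0 ta ta' xB).
  have sx' : csummable (mv Z' x) by exact: csummable_mv Za' ta' sx.
  apply: le_trans (eZ _ sx') _; rewrite -mulrA.
  by apply: ler_wpM2l => //; exact: eZ'.
exists (madd (mmul Z G') G), (2 * rho * alpha * gamma' + gamma); split.
  by apply: mdecaysD => //; exact: mdecays_mmul.
rewrite {1}YG; apply/funext => k; apply/funext => l.
rewrite /madd addrA; congr (_ + _).
have -> : mmul (mmul Z Z') Y k l = mv Z (fun j => mmul Z' Y j l) k.
  by rewrite {1}/mmul (mv_mmul Za Za' a0 a'0 ta ta' (fun j => Y_bounded j l)).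
have G'_bounded : forall j, normc (G' j l) <= gamma'.
  by move=> j; exact: mdecays_entry dG' _ _.
have Z'Y_bounded j : normc (mmul Z' Y j l) <= L + gamma'.
  have -> : mmul Z' Y j l = Y j l - G' j l by rewrite {2}YG' /madd addrK.
  by apply: le_trans (normcB _ _) _; rewrite lerD.
have YE : (fun j => Y j l) = (fun j => mmul Z' Y j l + G' j l).
  by apply/funext => j; rewrite {1}YG'.
by rewrite {1}/mmul YE (mv_addr Za ta Z'Y_bounded G'_bounded).
Qed.

(** The energy bound is tested on the unit vector at [l], whose image is the column [l] of [Z]. *)
Lemma reduces_entry Z theta alpha k l : reduces Z theta alpha ->
  normc (Z k l) ^+ 2 <= theta.
Proof.
move=> [[a da Za] eZ _]; have [a0 _ _] := da; have ta := decays_lty da.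
pose x : int -> R[i] := fun j => mid j l; have sx : csummable x := csummable_unit l.
have := eZ x sx; rewrite energy_unit mulr1; apply: le_trans.
have -> : Z k l = mv Z x k by rewrite -[mv Z x k]/(mmul Z mid k l) mmul_mid.
by apply: entry_energy; exact: csummable_mv Za ta sx.
Qed.

Lemma reduces_power Z theta alpha m : 0 <= theta -> reduces Z theta alpha ->
  exists Z' alpha', reduces Z' (theta ^+ m.+1) alpha'.
Proof.
move=> th0 rZ; elim: m => [|m [Z' [alpha' rZ']]]; first by exists Z, alpha.
exists (mmul Z Z'), (2 * rho * alpha * alpha'); rewrite exprS.
apply: (reduces_mmul th0 rZ rZ'); apply: mdecays_mmul => //; first by case: rZ.
by case: rZ'.
Qed.

Lemma reduces_small Z theta alpha e : 0 <= theta < 1 -> reduces Z theta alpha ->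
  0 < e -> exists Z' theta' alpha', reduces Z' theta' alpha' /\ alpha' < e.
Proof.
move=> /andP[th0 th1] rZ e0; have rho0 : 0 < rho by rewrite (lt_trans ltr01).
(* With [16^-1] the entries at stage [j] are at most [4^-1 ^+ n], where [n = 2 ^ j]; this outweighs
   the factor [2 ^ n] that counts the near diagonals in [mdecays_sqr]. *)
have [m hm] : exists m, theta ^+ m < 16^-1.
  by apply: small_power; rewrite ?th0// invr_gt0.
have [Z0 [alpha0 rZ0]] := reduces_power m th0 rZ.
have {}rZ0 : reduces Z0 16^-1 alpha0.
  apply: le_reduces rZ0; rewrite exprS; apply: le_trans (ltW hm).
  by rewrite ler_piMl ?exprn_ge0// ltW.
(* The interpolated mass is at most [2 * 2^-1 ^+ n] from the near diagonals plus [b j * rho^-1 ^+ n]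
   from the tail; [nu] dominates both rates. *)
pose nu := Num.max 2^-1 rho^-1.
have nu2 : 2^-1 <= nu by rewrite le_max lexx.
have nur : rho^-1 <= nu by rewrite le_max lexx orbT.
have nu01 : 0 < nu < 1.
  apply/andP; split; first by apply: lt_le_trans nu2; rewrite invr_gt0.
  by rewrite gt_max !invf_lt1// ltr1n.
pose b := fix b j := if j is j'.+1 then
  2 * rho * b j' * ((2 + b j') * nu ^+ (2 ^ j')) else alpha0.
have hb j : exists Z, reduces Z (16^-1 ^+ (2 ^ j)) (b j).
  elim: j => [|j [Zj rj]]; first by exists Z0; rewrite expr1.
  exists (mmul Zj Zj); rewrite expnS mul2n -addnn exprD.
  apply: (reduces_mmul _ rj rj); first by rewrite exprn_ge0.
  have [dj _ _] := rj; have bj0 := mdecays_ge0 dj.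
  have entry k l : normc (Zj k l) <= 4^-1 ^+ (2 ^ j).
    rewrite -(ler_pXn2r (n := 2))// ?nnegrE ?normc_ge0 ?exprn_ge0//.
    apply: le_trans (reduces_entry k l rj) _.
    by rewrite -exprM mulnC exprM (_ : 4^-1 ^+ 2 = 16^-1)//; field.
  have [a da Zja] := mdecays_sqr rho1 (2 ^ j) dj entry.
  exists a => //; have [a0 _ _] := da; apply: (le_decays rho1 a0 _ _ da) => //=.
  apply: ler_wpM2l; first by rewrite mulr_ge0// mulr_ge0// ltW.
  set n := (2 ^ j)%N; rewrite [leRHS]mulrDl; apply: lerD.
    rewrite mulrCA ler_wpM2l// natrX -exprMn.
    rewrite (_ : 2 * 4^-1 = 2^-1); last by field.
    by rewrite lerXn2r ?nnegrE ?invr_ge0// (le_trans _ nu2)// invr_ge0.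
  rewrite ler_wpM2l// -exprVn lerXn2r ?nnegrE ?invr_ge0 ?(ltW rho0)//.
  by rewrite (le_trans _ nu2)// invr_ge0.
have b0 j : 0 <= b j by have [Zj [/mdecays_ge0]] := hb j.
have [|j hj] := doubling_recursion_small (C := 2 * rho) _ nu01 b0 (fun=> lexx _) e0.
  by rewrite mulr_ge0// ltW.
by have [Zj rj] := hb j; exists Zj, (16^-1 ^+ (2 ^ j)), (b j).
Qed.

Theorem reduces_mdecays Z theta alpha : 0 <= theta < 1 ->
  reduces Z theta alpha -> exists beta, mdecays rho Y beta.
Proof.
move=> th rZ; have rho0 : 0 < rho by rewrite (lt_trans ltr01).
(* Below this threshold [zeta] satisfies the condition [2 * rho * zeta <= 2^-1] of
   [mdecays_fixed_point]. *)
have e0 : 0 < (4 * rho)^-1 by rewrite invr_gt0 mulr_gt0.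
have [Z' [theta' [zeta [[dZ' _ [G [gamma [dG YE]]]] hz]]]] := reduces_small th rZ e0.
exists (2 * gamma); apply: (mdecays_fixed_point rho1 Y_bounded dZ' _ dG YE).
move: hz; rewrite -[X in _ < X]mul1r ltr_pdivlMr ?mulr_gt0//; nra.
Qed.

End iterated_squaring.

(** * Dyadic decay in terms of tails *)

Section dyadic_shells.
Context {R : realType}.
Implicit Types (a : int -> \bar R) (A : zmatrix R).

Lemma powR2_gt1 (r : R) : 0 < r -> 1 < 2 `^ r.
Proof.
move=> r0; have p1 : 1 `^ r = 1 :> R by rewrite powR1.
rewrite -[ltLHS]p1.
by apply: (gt0_ltr_powR r0); rewrite ?nnegrE ?ler01 ?ler0n ?ltr1n.
Qed.

Lemma exp_powR (r : R) k : 2 `^ (k%:R * r) = (2 `^ r) ^+ k.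
Proof. by rewrite mulrC powRrM powR_mulrn// powR_ge0. Qed.

Lemma dyadic_shell_inj i j l : dyadic_shell i l -> dyadic_shell j l -> i = j.
Proof.
move=> /andP[i1 i2] /andP[j1 j2]; apply/eqP; rewrite eqn_leq.
rewrite -ltnS -(ltn_exp2l (m := 2))// (leq_ltn_trans i1 j2) /=.
by rewrite -ltnS -(ltn_exp2l (m := 2))// (leq_ltn_trans j1 i2).
Qed.

(** The shells from level [k] on partition [|l| >= 2^k]; the level of [l] is the integer part of the
    binary logarithm of [|l|]. *)
Lemma tail_shells a k : (forall l, 0 <= a l)%E ->
  tail a (2 ^ k) = (\esum_(i in setT) \esum_(l in dyadic_shell (k + i)) a l)%E.
Proof.
move=> a0; rewrite -esum_bigcupT//; last first.
  move=> i j _ _ [l [h1 h2]]; apply/eqP.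
  by rewrite -(eqn_add2l k); apply/eqP; exact: dyadic_shell_inj h1 h2.
rewrite /tail /mass esum_mkcond [RHS]esum_mkcond; apply: eq_esum => l _.
rewrite in_setT /outer; congr (if _ then _ else _).
apply/idP/idP => [kl|/set_mem[i _ /andP[+ _]]]; last first.
  by apply: leq_trans; rewrite leq_exp2l// leq_addr.
have l0 : (0 < `|l|)%N by rewrite (leq_trans _ kl)// expn_gt0.
have kt : (k <= trunc_log 2 `|l|)%N by exact: trunc_log_max.
apply/mem_set; exists (trunc_log 2 `|l| - k)%N => //.
by rewrite subnKC//; exact: trunc_log_bounds.
Qed.

Lemma esum_geometric (c x : R) : 0 <= c -> 0 <= x < 1 ->
  (\esum_(i in [set: nat]) (c * x ^+ i)%:E <= (c / (1 - x))%:E)%E.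
Proof.
move=> c0 /andP[x0 x1]; have y0 : 0 < 1 - x by rewrite subr_gt0.
have p0 n : 0 <= c * x ^+ n by rewrite mulr_ge0// exprn_ge0.
rewrite -nneseries_esumT//.
apply: lime_le; first by apply: is_cvg_nneseries => n _ _; rewrite lee_fin.
apply: nearW => n; rewrite sumEFin lee_fin.
suff -> : \sum_(0 <= i < n) c * x ^+ i = c / (1 - x) - c * x ^+ n / (1 - x).
  by rewrite gerBl divr_ge0// ltW.
elim: n => [|n IH]; first by rewrite big_nil expr0 mulr1 subrr.
rewrite big_nat_recr//= IH exprS; field.
by rewrite gt_eqF.
Qed.

(** The shell bounds [C * rho^-k] form a geometric series, convergent because [r > 0] means
    [rho > 1]. The main diagonal lies in no shell and contributes its own supremum. *)
Lemma dyadic_decay_mdecays (r : R) A : 0 < r -> dyadic_decay r A ->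
  exists alpha, mdecays (2 `^ r) A alpha.
Proof.
move=> r0 [hdiag [C hC]]; set rho := 2 `^ r in hC *.
have rho1 : 1 < rho by exact: powR2_gt1.
have rho0 : 0 < rho by rewrite (lt_trans ltr01).
pose x := rho^-1; have x01 : 0 <= x < 1 by rewrite invr_ge0 ltW//= invf_lt1.
pose d := diag_sup A; have d0 : forall l, (0 <= d l)%E by exact: diag_sup_ge0.
have d00 : (d 0%R < +oo)%E.
  apply: le_lt_trans hdiag; apply: ge_ereal_sup => _ [m _ <-].
  by rewrite subr0; apply: ereal_sup_ubound; exists m.
have shell k : (\esum_(l in dyadic_shell k) d l <= (C * x ^+ k)%:E)%E.
  have := hC k; rewrite exp_powR -/rho -lee_pdivlMl ?exprn_gt0//.
  by rewrite -EFinM mulrC exprVn.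
have C0 : 0 <= C.
  have := shell 0%N; rewrite expr0 mulr1 -lee_fin; apply: le_trans.
  by apply: esum_ge0 => l _; exact: d0.
have dtail k : (tail d (2 ^ k) <= (x ^+ k * (C / (1 - x)))%:E)%E.
  rewrite tail_shells// mulrA.
  apply: le_trans (esum_geometric (mulr_ge0 (exprn_ge0 k _) C0) x01); last first.
    by case/andP: x01.
  apply: le_esum => i _; apply: le_trans (shell _) _.
  by rewrite lee_fin exprD mulrA (mulrC C).
have y0 : 0 < 1 - x by rewrite subr_gt0; case/andP: x01.
have f0 : d 0 = (fine (d 0))%:E by rewrite fineK// ge0_fin_numE.
exists (fine (d 0) + C / (1 - x)), d; last exact: dominated_diag_sup.
split=> // [|k].
  rewrite EFinD -f0.
  (* The condition [|l| >= 2^0] says exactly that [l] is nonzero. *)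
  apply: (@le_trans _ _ (d 0%R + tail d (2 ^ 0))%E); last first.
    by rewrite leeD2l// (le_trans (dtail 0%N))// expr0 mul1r.
  rewrite -{1}(mass_delta (0 : int) (d0 0)) -massD; last 2 first.
  - by move=> l; case: ifP.
  - exact: outer_ge0.
  apply: le_mass => l; rewrite /outer.
  have [->|l0] := eqVneq l 0; first by rewrite leeDl//; case: ifP.
  by rewrite add0e expn0 absz_gt0 l0.
apply: (@le_trans _ _ (C / (1 - x))%:E); last first.
  by rewrite lee_fin lerDr fine_ge0.
by rewrite -lee_pdivlMl ?exprn_gt0// -EFinM -exprVn.
Qed.

(** Each shell is contained in the tail that starts at the same power of [2]. *)
Lemma mdecays_dyadic_decay (r : R) A alpha :
  mdecays (2 `^ r) A alpha -> dyadic_decay r A.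
Proof.
move=> dA; split.
  apply: (@le_lt_trans _ _ alpha%:E); last exact: ltry.
  by apply: ge_ereal_sup => _ [k _ <-]; rewrite lee_fin; exact: mdecays_entry dA _ _.
have [a [a0 _ ta] Aa] := dA; exists alpha => k; rewrite exp_powR.
apply: le_trans (ta k); apply: lee_wpmul2l.
  by rewrite lee_fin exprn_ge0// powR_ge0.
rewrite esum_mkcond; apply: le_mass => l; rewrite /outer.
case: ifPn => [/set_mem /andP[-> _]|_]; first exact: diag_sup_le.
by case: ifP.
Qed.

End dyadic_shells.

(** * Operators on [l2] and their matrices *)

Section l2_operators.
Context {R : realType}.
Implicit Types (A : zmatrix R) (T S : {linear l2 R -> l2 R}).

Lemma l2_sqr_norm (x : l2 R) : csummable (x : int -> R[i]) ->
  l2norm x ^+ 2 = energy (x : int -> R[i]).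
Proof. by move=> sx; rewrite /l2norm l2energyE// sqr_sqrtr ?energy_ge0. Qed.

Lemma normc_le_l2norm (x : l2 R) k : normc (x k) <= l2norm x.
Proof.
have fx : (l2energy (x : int -> R[i]) < +oo)%E by have /set_mem := l2funP x.
have p l : (0 <= (normc (x l) ^+ 2)%:E :> \bar R)%E by rewrite lee_fin sqr_ge0.
have f0 : (0 <= l2energy (x : int -> R[i]))%E by apply: esum_ge0 => l _; exact: p.
rewrite /l2norm -[normc _]ger0_norm ?normc_ge0// -sqrtr_sqr ler_sqrt ?fine_ge0//.
rewrite -lee_fin fineK ?ge0_fin_numE//.
exact: (esum_ge_term (a := fun l => (normc (x l) ^+ 2)%:E)).
Qed.

Lemma csummable_l2 (x : int -> R[i]) : csummable x ->
  exists X : l2 R, (X : int -> R[i]) = x.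
Proof.
move=> sx; have h : x \in square_summable by apply/mem_set; rewrite /= l2energyE// ltry.
by exists (L2 h).
Qed.

(** Rows of [A] are absolutely summable and [l2] vectors have bounded entries, so the net limits
    defining [T x] are absolutely convergent sums. *)
Lemma induces_mv A a T : dominated A a -> (mass a < +oo)%E -> induces A T ->
  forall x : l2 R, (T x : int -> R[i]) = mv A (x : int -> R[i]).
Proof.
move=> Aa ta hT x; apply/funext => k; apply: cvg_partial_sum_csum (hT x k).
exact: csummable_mv_term Aa ta (normc_le_l2norm x).
Qed.

Lemma l2_bounded_energy T (x : l2 R) (M : R) :
  (forall x, l2norm (T x) <= M * l2norm x) ->
  l2norm (T x) ^+ 2 <= (M ^+ 2 + 1) * l2norm x ^+ 2.
Proof.
move=> hM; apply: (@le_trans _ _ ((M * l2norm x) ^+ 2)).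
  by rewrite lerXn2r ?nnegrE ?sqrtr_ge0// (le_trans _ (hM x))// sqrtr_ge0.
by rewrite exprMn ler_wpM2r ?sqr_ge0// lerDl.
Qed.

End l2_operators.

(** * Decay of the matrix of the inverse operator *)

Theorem theorem1p3 (R : realType) (A : zmatrix R) (r : R) (hr : 0 < r)
    (hA : dyadic_decay r A)
    (T S : {linear l2 R -> l2 R})
    (hAT : induces A T) (hT : l2_bounded T) (hS : l2_bounded S)
    (hST : cancel T S) (hTS : cancel S T) :
  dyadic_decay r (matrix_of S).
Proof.
have [alpha dA] := dyadic_decay_mdecays hr hA.
have rho1 := powR2_gt1 hr.
have [a da Aa] := dA; have [a0 _ _] := da; have ta := decays_lty da.
have TE := induces_mv Aa ta hAT.
have [M hM] := hT; have [K hK] := hS.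
(* Energies are squared norms, whence the squares. Adding [1] gives [mu * kappa >= 1] whatever the
   signs of [M] and [K], so the contraction factor [1 - (mu * kappa)^-1] lies in [[0, 1)]. *)
set Y := matrix_of S; set mu := M ^+ 2 + 1; set kappa := K ^+ 2 + 1.
have mu1 : 1 <= mu by rewrite lerDr sqr_ge0.
have kappa1 : 1 <= kappa by rewrite lerDr sqr_ge0.
have hle (x : int -> R[i]) : csummable x -> energy (mv A x) <= mu * energy x.
  move=> sx; have [X XE] := csummable_l2 sx.
  have := l2_bounded_energy X hM; rewrite !l2_sqr_norm ?TE ?XE//.
  exact: csummable_mv Aa ta sx.
(* The lower bound on [A] is the boundedness of [S], applied to [T X]. *)
have hge (x : int -> R[i]) : csummable x -> energy x <= kappa * energy (mv A x).
  move=> sx; have [X XE] := csummable_l2 sx.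
  have := l2_bounded_energy (T X) hK; rewrite hST !l2_sqr_norm ?TE ?XE//.
  exact: csummable_mv Aa ta sx.
have unit_norm l : l2norm (l2unit l : l2 R) = 1.
  by rewrite /l2norm l2energyE ?energy_unit ?sqrtr1//; exact: csummable_unit.
have Y_bounded k l : normc (Y k l) <= K.
  by apply: le_trans (normc_le_l2norm _ _) _; rewrite -[K]mulr1 -(unit_norm l).
have AY : mmul A Y = mid.
  apply/funext => k; apply/funext => l.
  by rewrite -[LHS]/(mv A (S (l2unit l) : int -> R[i]) k) -TE hTS.
have dA' := mdecays_adj dA; have [a' da' Aa'] := dA'.
have ta' := decays_lty da'; have [a'0 _ _] := da'.
pose P := mmul (adj A) A; have dP := mdecays_mmul (ltW rho1) dA' dA.
have [p dp Pp] := dP; have tp := decays_lty dp.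
pose Q := madd mid (zscale (- mu^-1) P).
have [beta dQ] : exists beta, mdecays (2 `^ r) Q beta.
  by eexists; apply: mdecaysD; [exact: mdecays_mid|exact: mdecaysZ dP].
have QE (x : int -> R[i]) B : (forall l, normc (x l) <= B) ->
    mv Q x = (fun k => x k - (mu^-1)%:C * mv (adj A) (mv A x) k).
  move=> xB; have [i di Ii] := mdecays_mid (2 `^ r : R).
  have [q dq Pq] := mdecaysZ (- mu^-1) dP.
  rewrite (mv_madd Ii Pq (decays_lty di) (decays_lty dq) xB) mv_mid.
  rewrite (mv_zscale _ Pp tp xB) (mv_mmul Aa' Aa a'0 a0 ta' ta xB).
  by apply/funext => k; rewrite rmorphN mulNr.
have mk1 : 1 <= mu * kappa by rewrite mulr_ege1.
have mk0 : 0 < mu * kappa by rewrite (lt_le_trans ltr01).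
have theta01 : 0 <= 1 - (mu * kappa)^-1 < 1.
  by rewrite subr_ge0 invf_le1// mk1 ltrBlDr ltrDl invr_gt0.
suff rQ : reduces (2 `^ r) Y Q (1 - (mu * kappa)^-1) beta.
  have [gamma dY] := reduces_mdecays rho1 Y_bounded theta01 rQ.
  exact: mdecays_dyadic_decay dY.
split=> // [x sx|].
  have [B xB] := csummable_bounded sx.
  rewrite (QE _ _ xB).
  exact: (richardson_contraction Aa a0 ta mu1 kappa1 hle hge sx).
(* Since [A Y] is the identity, [Q Y = Y - A^* A Y / mu = Y - A^* / mu], which identifies the
   remainder. *)
exists (zscale mu^-1 (adj A)), (`|mu^-1| * alpha); split; first exact: mdecaysZ.
apply/funext => k; apply/funext => l.
rewrite /madd {1}/mmul (QE _ K)//.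
have -> : mv A (fun j => Y j l) = (fun j => mid j l).
  by apply/funext => j; rewrite -AY.
by rewrite -[mv (adj A) _ k]/(mmul (adj A) mid k l) mmul_mid /zscale subrK.
Qed.
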